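(* Let $A$ be a unital semi-simple commutative Banach algebra, $U$ an automorphism of $A$, and $w \in A$. Let $T = wU$ and let $\check{T}$ be the associated weighted composition operator on $\check{A}$. Assume that (a) $w$ is an invertible element of $A$, and (b) $\sigma(\check{T}) = \mathbb{T} \subseteq \sigma(T)$. Then the set $\sigma(T)$ is connected.
   Context: $A$ is a unital commutative semi-simple Banach algebra with maximal ideal space $\mathfrak{M}_A$ and Shilov boundary $\partial A$. For $f\in A$, $\check f$ is the restriction of the Gelfand transform $\hat f$ to $\partial A$; $\check A$ is the closure of $\{\check f: f\in A\}$ in $C(\partial A)$ with sup norm. The automorphism $U$ induces a homeomorphism $\varphi$ of $\mathfrak{M}_A$ by $\widehat{Uf}(m)=\hat f(\varphi(m))$, with $\varphi(\partial A)=\partial A$. $T=wU$ means $Tf=w\cdot Uf$; $\check T$ is the operator on $\check A$ given by $(\check Tg)(t)=\check w(t)g(\varphi(t))$, $t\in\partial A$. $\mathbb{T}$ is the unit circle. *)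

(* Defs.v *)
(* Complex numbers are R[i] for R : realType
   (mathcomp-real-closed `complex`), seen as a numClosedFieldType, hence with the
   metric topology of num_topology. *)
From HB Require Import structures.
From mathcomp Require Import all_boot all_order all_algebra all_classical all_reals all_analysis.
From mathcomp Require Import complex.
Import numFieldNormedType.Exports.
Set Implicit Arguments. Unset Strict Implicit. Unset Printing Implicit Defensive.
Import Order.TTheory GRing.Theory Num.Theory.
Local Open Scope classical_set_scope.
Local Open Scope ring_scope.
Local Open Scope complex_scope.

Definition Cplx (R : realType) : numClosedFieldType := R[i].

Section BanachAlgebra.
Variables (R : realType).
Local Notation C := (Cplx R).
Variables (A : completeNormedModType C) (mul : A -> A -> A) (one : A).

Definition is_unital_comm_banach_algebra : Prop :=
  (forall x y z, mul x (mul y z) = mul (mul x y) z) /\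
  (forall x y, mul x y = mul y x) /\
  (forall x, mul one x = x) /\
  (forall (a : C) x y z, mul (a *: x + y) z = a *: mul x z + mul y z) /\
  (forall x y, `|mul x y| <= `|x| * `|y|) /\
  one != 0.

Definition is_ideal (I : set A) : Prop :=
  [/\ I 0, (forall x y, I x -> I y -> I (x - y))
    & (forall a x, I x -> I (mul a x))].

Definition is_proper_ideal (I : set A) : Prop := is_ideal I /\ ~ I one.

Definition is_maximal_ideal (I : set A) : Prop :=
  is_proper_ideal I /\
  (forall J : set A, is_proper_ideal J -> I `<=` J -> J = I).

Definition radical : set A :=
  [set x | forall I : set A, is_maximal_ideal I -> I x].

Definition semisimple : Prop := radical = [set 0].

Definition invertible (w : A) : Prop := exists v, mul w v = one.

Definition is_automorphism (U : A -> A) : Prop :=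
  [/\ (forall (a : C) x y, U (a *: x + y) = a *: U x + U y),
      (forall x y, U (mul x y) = mul (U x) (U y)),
      U one = one
    & bijective U].

(* characters = points of the maximal ideal space M_A;
   a point m is represented by the character m : A -> C, and the Gelfand
   transform is  \hat f (m) = m f *)
Definition is_character (m : A -> C) : Prop :=
  [/\ (forall (a : C) x y, m (a *: x + y) = a * m x + m y),
      (forall x y, m (mul x y) = m x * m y)
    & m one = 1].

Definition max_ideal_space : set (A -> C) := [set m | is_character m].

(* closed sets of M_A for the Gelfand (weak-star) topology: the topology of
   M_A generated by the Gelfand transforms m |-> m f *)
Definition gelfand_closed (S : set (A -> C)) : Prop :=
  S `<=` max_ideal_space /\
  forall m, is_character m -> ~ S m ->
    exists (fs : seq A) (e : R), 0 < e /\
      forall m', is_character m' ->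
        (forall f, f \in fs -> `|m' f - m f| < e%:C) -> ~ S m'.

Definition is_boundary (S : set (A -> C)) : Prop :=
  S `<=` max_ideal_space /\
  forall f : A, exists2 m, S m &
    forall m', is_character m' -> `|m' f| <= `|m f|.

Definition shilov_boundary : set (A -> C) :=
  [set m | forall S, gelfand_closed S -> is_boundary S -> S m].

(* the Banach space \check A: the closure of { \check f | f in A } in
   C(\partial A) with the sup norm.  Functions are represented as maps
   (A -> C) -> C, only their values on the Shilov boundary matter. *)
Definition in_checkA (g : (A -> C) -> C) : Prop :=
  forall e : R, 0 < e -> exists f : A,
    forall t, shilov_boundary t -> `|t f - g t| <= e%:C.

Definition wcomp (w : A) (U : A -> A) : A -> A := fun f => mul w (U f).

Definition spectrumA (T : A -> A) : set C :=
  [set lam | ~ exists S : A -> A,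
     [/\ exists K : C, forall f, `|S f| <= K * `|f|,
         (forall f, S (T f - lam *: f) = f)
       & (forall f, T (S f) - lam *: S f = f)]].

(* the operator \check T on \check A : (\check T g)(t) = \check w(t) g(phi(t)),
   where phi(t) = t \o U is the homeomorphism of M_A induced by U *)
Definition check_wcomp (w : A) (U : A -> A) (g : (A -> C) -> C) : (A -> C) -> C :=
  fun t => t w * g (t \o U).

Definition eq_on_boundary (g h : (A -> C) -> C) : Prop :=
  forall t, shilov_boundary t -> g t = h t.

Definition bdd_by (g : (A -> C) -> C) (M : C) : Prop :=
  forall t, shilov_boundary t -> `|g t| <= M.

Definition spectrum_checkA (Tc : ((A -> C) -> C) -> ((A -> C) -> C)) : set C :=
  [set lam | ~ exists S : ((A -> C) -> C) -> ((A -> C) -> C),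
     [/\ (forall g, in_checkA g -> in_checkA (S g)),
         (forall g h, in_checkA g -> eq_on_boundary g h -> eq_on_boundary (S g) (S h)),
         (exists K : C, forall g M, in_checkA g -> bdd_by g M -> bdd_by (S g) (K * M)),
         (forall g, in_checkA g ->
            eq_on_boundary (S (fun t => Tc g t - lam * g t)) g)
       & (forall g, in_checkA g ->
            eq_on_boundary (fun t => Tc (S g) t - lam * S g t) g)]].

End BanachAlgebra.

Definition unit_circle (R : realType) : set (Cplx R) := [set z | `|z| = 1].
Arguments unit_circle R : clear implicits.

(* Main.v *)
(* Characters embed A in the functions on its Shilov boundary, and this embedding
   J intertwines T with T^. If the spectrum of T had a relatively clopen part K off
   the unit circle, K would lie where T^ - z is invertible, although T - l is not
   invertible for l in K. Let G be a grid contour around K inside the resolvent set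
   of T. Then h = oint_G R(z) f / (z - l) dz satisfies
   (T - l) h = 2 i pi f + oint_G R(z) f dz, and J maps the last integral to the
   integral of the function z |-> (T^ - z)^-1 J f, holomorphic inside G: it is 0 by
   Goursat. So T - l is onto, and it is injective because T^ - l is.

   Integrals are limits of midpoint sums over dyadically refined segments. Edges
   shared by two squares of the grid cancel already in the finite sums, so that no
   condition is needed on the integrand there, and the non-zero constant replacing
   2 i pi only has to be bounded below. *)
Require Import Defs.
From HB Require Import structures.
From mathcomp Require Import all_boot all_order all_algebra all_classical all_reals all_analysis.
From mathcomp Require Import complex lra ring.
Import numFieldNormedType.Exports.
Set Implicit Arguments. Unset Strict Implicit. Unset Printing Implicit Defensive.
Import Order.TTheory GRing.Theory Num.Theory.
Local Open Scope classical_set_scope.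
Local Open Scope ring_scope.

(** * Real-valued norms and sequential limits *)

Section Norm.
Variable R : realType.
Local Notation C := (Cplx R).

(** The obstacle is that z |-> R(z) f has no meaning on K, so Cauchy's theorem cannot be applied to
    it in A. Only its image under J continues across K, and it agrees with that continuation merely
    on the contour. Two integrands that agree on the contour and differ inside must therefore have
    equal grid sums.

    The squares that meet K have to avoid a closed set F, made of the rest of the spectrum of T and
    of the points where T^ - z may fail to be invertible; the mesh comes from the distance between K
    and F.

    The circle is connected and lies in the spectrum of T, so a relatively clopen part of the
    spectrum contains it or misses it. One of the two complementary parts is then off the circle,
    hence empty.

    Two facts are purely algebraic at the start and become analytic through the closed graph
    theorem: T is bounded although U is only an algebra automorphism, and a bijective T - l has a
    bounded inverse. Injectivity of J rests on the existence of enough points in the Shilov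
    boundary, and this on the Gelfand-Mazur theorem, which is drawn from the same version of
    Goursat's theorem. *)

Definition cre (z : C) : R := complex.Re z.
Definition cim (z : C) : R := complex.Im z.
Definition rc (x : R) : C := (x%:C)%C.
Definition cpx (x y : R) : C := (x +i* y)%C.
(** The norm of a space over [C] takes its values in [C]. Its real part carries the same information
    ([nrmE]) and keeps all estimates in the ordered field [R]. *)
Definition nrm (V : normedZmodType C) (x : V) : R := cre `|x|.

Arguments cre : simpl never.
Arguments cim : simpl never.
Arguments rc : simpl never.
Arguments cpx : simpl never.

Lemma cplx_eqP (z w : C) : cre z = cre w -> cim z = cim w -> z = w.
Proof. by case: z w => [a b] [c d]; rewrite /cre /cim /= => -> ->. Qed.

Lemma creD z w : cre (z + w) = cre z + cre w. Proof. by case: z w => ? ? []. Qed.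
Lemma cimD z w : cim (z + w) = cim z + cim w. Proof. by case: z w => ? ? []. Qed.
Lemma creN z : cre (- z) = - cre z. Proof. by case: z. Qed.
Lemma cimN z : cim (- z) = - cim z. Proof. by case: z. Qed.
Lemma creM z w : cre (z * w) = cre z * cre w - cim z * cim w.
Proof. by case: z w => ? ? []. Qed.
Lemma cimM z w : cim (z * w) = cre z * cim w + cim z * cre w.
Proof. by case: z w => ? ? []. Qed.
Lemma creE x y : cre (cpx x y) = x. Proof. by []. Qed.
Lemma cimE x y : cim (cpx x y) = y. Proof. by []. Qed.
Lemma cre_rc x : cre (rc x) = x. Proof. by []. Qed.
Lemma cim_rc x : cim (rc x) = 0. Proof. by []. Qed.
Lemma cre0 : cre 0 = 0. Proof. by []. Qed.
Lemma cim0 : cim 0 = 0. Proof. by []. Qed.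
Lemma cre1 : cre 1 = 1. Proof. by []. Qed.
Lemma cim1 : cim 1 = 0. Proof. by []. Qed.
Definition cE := (creD, cimD, creN, cimN, creM, cimM, creE, cimE, cre_rc, cim_rc, cre0, cim0, cre1, cim1).

Lemma rcM x y : rc (x * y) = rc x * rc y. Proof. by apply: cplx_eqP; rewrite !cE; lra. Qed.
Lemma rc1 : rc 1 = 1. Proof. by []. Qed.
Lemma rc0 : rc 0 = 0. Proof. by []. Qed.

Lemma rc_le (x y : R) : (rc x <= rc y) = (x <= y).
Proof. by rewrite lecE /= eqxx. Qed.
Lemma rc_lt (x y : R) : (rc x < rc y) = (x < y).
Proof. by rewrite ltcE /= eqxx. Qed.

Lemma cre_le (z w : C) : z <= w -> cre z <= cre w.
Proof. by rewrite lecE => /andP[]. Qed.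

Variable V : normedModType C.
Implicit Types x y : V.

Lemma nrmE (W : normedZmodType C) (x : W) : `|x| = rc (nrm x).
Proof.
apply: cplx_eqP => //; have: (0 : C) <= `|x| by exact: normr_ge0.
by rewrite lecE => /andP[/eqP].
Qed.

Lemma nrm_ge0 (W : normedZmodType C) (x : W) : 0 <= nrm x.
Proof. exact: (cre_le (normr_ge0 x)). Qed.

Lemma nrmD (W : normedZmodType C) (x y : W) : nrm (x + y) <= nrm x + nrm y.
Proof. by have /cre_le := ler_normD x y; rewrite creD. Qed.

Lemma nrm0 (W : normedZmodType C) : nrm (0 : W) = 0.
Proof. by rewrite /nrm normr0. Qed.

Lemma nrmN (W : normedZmodType C) (x : W) : nrm (- x) = nrm x.
Proof. by rewrite /nrm normrN. Qed.

Lemma nrmB (W : normedZmodType C) (x y : W) : nrm (x - y) = nrm (y - x).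
Proof. by rewrite -nrmN opprB. Qed.

Lemma nrmBD (W : normedZmodType C) (x y : W) : nrm (x - y) <= nrm x + nrm y.
Proof. by rewrite -[nrm y]nrmN nrmD. Qed.

Lemma nrm_trans (W : normedZmodType C) (y x z : W) :
  nrm (x - z) <= nrm (x - y) + nrm (y - z).
Proof. by rewrite -[x - z](subrKA y) nrmD. Qed.

Lemma nrm_eq0 (W : normedZmodType C) (x : W) : nrm x = 0 -> x = 0.
Proof. by move=> e; apply/normr0_eq0; rewrite nrmE e. Qed.

Lemma nrm_le0 (W : normedZmodType C) (x : W) : nrm x <= 0 -> x = 0.
Proof. by move=> e; apply/nrm_eq0/le_anti; rewrite e nrm_ge0. Qed.

Lemma nrmZ (a : C) x : nrm (a *: x) = nrm a * nrm x.
Proof. by rewrite {1}/nrm normrZ !nrmE -rcM. Qed.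

Lemma nrmM (a b : C) : nrm (a * b) = nrm a * nrm b.
Proof. by rewrite {1}/nrm normrM !nrmE -rcM. Qed.

Lemma nrm1 : nrm (1 : C) = 1.
Proof. by rewrite /nrm normr1. Qed.

Lemma nrmV (a : C) : nrm a^-1 = (nrm a)^-1.
Proof.
have [->|a0] := eqVneq a 0; first by rewrite invr0 nrm0 invr0.
have na : nrm a != 0 by apply: contra_neq a0; exact: nrm_eq0.
by apply: (mulfI na); rewrite -nrmM !mulfV // nrm1.
Qed.

Lemma nrmX (a : C) n : nrm (a ^+ n) = nrm a ^+ n.
Proof. by elim: n => [|n IH]; rewrite ?expr0 ?nrm1 // !exprS nrmM IH. Qed.

Lemma nrm_sqr (a : C) : nrm a ^+ 2 = cre a ^+ 2 + cim a ^+ 2.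
Proof.
by rewrite /nrm normc_def sqr_sqrtr // addr_ge0 // sqr_ge0.
Qed.

Lemma nrm_rc (x : R) : nrm (rc x) = `|x|.
Proof.
apply/eqP; rewrite -(eqrXn2 (n:=2)) ?nrm_ge0 // nrm_sqr /= real_normK ?num_real //.
by rewrite cre_rc cim_rc expr0n addr0.
Qed.

Lemma nrm_rc_ge0 (x : R) : 0 <= x -> nrm (rc x) = x.
Proof. by move=> x0; rewrite nrm_rc ger0_norm. Qed.

Lemma nrm_cim1 : nrm (cpx 0 1) = 1.
Proof.
apply/eqP; rewrite -(eqrXn2 (n:=2)) ?nrm_ge0 // nrm_sqr /=.
by rewrite creE cimE expr0n !expr1n add0r.
Qed.

Lemma cre_le_nrm (a : C) : `|cre a| <= nrm a.
Proof.
rewrite -(ler_pXn2r (n:=2)) ?nnegrE ?nrm_ge0 // nrm_sqr real_normK ?num_real //.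
by rewrite lerDl sqr_ge0.
Qed.

Lemma cim_le_nrm (a : C) : `|cim a| <= nrm a.
Proof.
rewrite -(ler_pXn2r (n:=2)) ?nnegrE ?nrm_ge0 // nrm_sqr real_normK ?num_real //.
by rewrite lerDr sqr_ge0.
Qed.

Lemma nrm_le_reim (a : C) : nrm a <= `|cre a| + `|cim a|.
Proof.
rewrite -(ler_pXn2r (n:=2)) ?nnegrE ?nrm_ge0 ?addr_ge0 // nrm_sqr sqrrD.
rewrite !real_normK ?num_real //.
have := mulr_ge0 (normr_ge0 (cre a)) (normr_ge0 (cim a)); lra.
Qed.

Lemma nrm_le (W : normedZmodType C) (x : W) (e : R) : (`|x| <= rc e) = (nrm x <= e).
Proof. by rewrite nrmE rc_le. Qed.
Lemma nrm_lt (W : normedZmodType C) (x : W) (e : R) : (`|x| < rc e) = (nrm x < e).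
Proof. by rewrite nrmE rc_lt. Qed.

Lemma nrm_pos (W : normedZmodType C) (x : W) : x != 0 -> 0 < nrm x.
Proof.
move=> x0; rewrite lt_def nrm_ge0 andbT; apply: contra_neq x0; exact: nrm_eq0.
Qed.

Lemma nbhs_nrmP x (P : set V) :
  nbhs x P <-> exists2 e : R, 0 < e & forall y, nrm (x - y) < e -> P y.
Proof.
split.
  move=> /nbhs_ballP[e /= e0 sub]; have eE : e = rc (cre e).
    by apply: cplx_eqP => //; move: e0; rewrite ltcE => /andP[/eqP].
  exists (cre e); first by rewrite -rc_lt -eE.
  move=> y xy; apply: sub; rewrite -ball_normE /= eE nrm_lt; exact: xy.
move=> [e e0 sub]; apply/nbhs_ballP; exists (rc e) => /=; first by rewrite -rc0 rc_lt.
by move=> y; rewrite -ball_normE /= nrm_lt => /sub.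
Qed.

Lemma open_nrmP (O : set V) :
  open O <-> forall x, O x -> exists2 e : R, 0 < e & forall y, nrm (x - y) < e -> O y.
Proof.
rewrite openE; split=> h x /h; first by move=> /nbhs_nrmP.
by move=> hx; apply/nbhs_nrmP.
Qed.

(** Stated over [normedZmodType], so that one notion serves sequences in [A] and in [C]. *)
Definition cvto (W : normedZmodType C) (u : nat -> W) (l : W) :=
  forall e : R, 0 < e -> exists N, forall n, (N <= n)%N -> nrm (u n - l) <= e.

End Norm.
Arguments cre {R}. Arguments cim {R}. Arguments rc {R}. Arguments cpx {R}.

Section Limits.
Variable R : realType.
Local Notation C := (Cplx R).

Lemma half_expr_small (K e : R) : 0 < e -> exists N : nat, forall n, (N <= n)%N -> K * (2^-1) ^+ n <= e.
Proof.
move=> e0; have [m Hm] : exists m : nat, `|K| / e < m%:R.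
  by exists (Num.bound (`|K| / e)); rewrite archi_boundP // divr_ge0 // ltW.
exists m => n mn; have nK : K * (2^-1) ^+ n <= `|K| * (2^-1) ^+ n.
  by rewrite ler_wpM2r ?exprn_ge0 // ler_norm.
apply: (le_trans nK); rewrite exprVn ler_pdivrMr ?exprn_gt0 // mulrC -ler_pdivrMr //.
apply: (le_trans (ltW Hm)); apply: (@le_trans _ _ n%:R); first by rewrite ler_nat.
by rewrite -natrX ler_nat ltnW // ltn_expl.
Qed.

Lemma cvto_unique (W : normedZmodType C) (u : nat -> W) l l' : cvto u l -> cvto u l' -> l = l'.
Proof.
move=> ul ul'; apply/eqP; rewrite -subr_eq0; apply/eqP/nrm_le0.
apply/ler_addgt0Pr => e e0; rewrite add0r.
have e2 : 0 < e / 2 by lra.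
have [N hN] := ul _ e2; have [M hM] := ul' _ e2.
have := hN (maxn N M) (leq_maxl _ _); have := hM (maxn N M) (leq_maxr _ _).
have := nrm_trans (u (maxn N M)) l l'; rewrite (nrmB l (u _)); lra.
Qed.

Lemma cvtoD (W : normedZmodType C) (u v : nat -> W) l l' :
  cvto u l -> cvto v l' -> cvto (fun n => u n + v n) (l + l').
Proof.
move=> ul vl e e0; have e2 : 0 < e / 2 by lra.
have [N hN] := ul _ e2; have [M hM] := vl _ e2.
exists (maxn N M) => n; rewrite geq_max => /andP[/hN h1 /hM h2].
rewrite opprD addrACA; apply: (le_trans (nrmD _ _)); lra.
Qed.

Lemma cvto_lip (W W' : normedZmodType C) (f : W -> W') (K : R) (u : nat -> W) l :
  (forall x y, nrm (f x - f y) <= K * nrm (x - y)) ->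
  cvto u l -> cvto (fun n => f (u n)) (f l).
Proof.
move=> hf ul e e0.
have K1 : 0 < `|K| + 1 by have := normr_ge0 K; lra.
have [N hN] := ul _ (divr_gt0 e0 K1); exists N => n /hN h.
apply: (le_trans (hf _ _)); apply: (@le_trans _ _ ((`|K| + 1) * nrm (u n - l))).
  by rewrite ler_wpM2r ?nrm_ge0 //; have := ler_norm K; lra.
by rewrite mulrC -ler_pdivlMr.
Qed.

Lemma cvtoZ (V : normedModType C) (a : C) (u : nat -> V) l :
  cvto u l -> cvto (fun n => a *: u n) (a *: l).
Proof. by apply: (cvto_lip (K := nrm a)) => x y; rewrite -scalerBr nrmZ. Qed.

Lemma cvtoZl (V : normedModType C) (x : V) (u : nat -> C) l :
  cvto u l -> cvto (fun n => u n *: x) (l *: x).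
Proof. by apply: (cvto_lip (K := nrm x) (f := fun a : C => a *: x)) => a b; rewrite -scalerBl nrmZ mulrC. Qed.

Lemma cvto_cst (W : normedZmodType C) (l : W) : cvto (fun=> l) l.
Proof. by move=> e e0; exists 0%N => n _; rewrite subrr nrm0 ltW. Qed.

Lemma cvto_le (W : normedZmodType C) (u : nat -> W) l (M : R) :
  cvto u l -> (forall n, nrm (u n) <= M) -> nrm l <= M.
Proof.
move=> ul hM; apply/ler_addgt0Pr => e e0.
have [N /(_ N (leqnn _)) hN] := ul _ e0.
have := nrm_trans (u N) l 0; rewrite !subr0 nrmB; have := hM N; lra.
Qed.

Lemma cvto_comp_add (W : normedZmodType C) (u : nat -> W) l k :
  cvto u l -> cvto (fun n => u (n + k)%N) l.
Proof.
by move=> h e /h[N hN]; exists N => n Nn; apply: hN; rewrite (leq_trans Nn) ?leq_addr.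
Qed.

Lemma cvto_shift (W : normedZmodType C) (u : nat -> W) l :
  cvto (fun n => u n.+1) l -> cvto u l.
Proof. by move=> h e /h[N hN]; exists N.+1 => -[//|n] /hN. Qed.

Lemma cvto_ext (W : normedZmodType C) (u v : nat -> W) l :
  (forall n, u n = v n) -> cvto u l -> cvto v l.
Proof. by move=> /funext ->. Qed.

(** Completeness of the Banach spaces enters the development here. The explicit error bound at n = 0
    is what yields norm estimates for the limit. *)
Lemma geometric_cvto (V : completeNormedModType C) (u : nat -> V) (K : R) :
  (forall n, nrm (u n.+1 - u n) <= K * (2^-1) ^+ n) ->
  exists2 l, cvto u l & forall n, nrm (u n - l) <= 2 * K * (2^-1) ^+ n.
Proof.
move=> h.
have K0 : 0 <= K by have := h 0%N; have := nrm_ge0 (u 1%N - u 0%N); rewrite expr0; lra.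
have hk n k : nrm (u (n + k)%N - u n) <= 2 * K * (2^-1) ^+ n * (1 - (2^-1) ^+ k).
  elim: k => [|k IH]; first by rewrite addn0 subrr nrm0 expr0; lra.
  rewrite addnS; apply: (le_trans (nrm_trans (u (n + k)%N) _ _)).
  apply: (le_trans (lerD (h _) IH)); rewrite exprD exprS; lra.
have hk2 n m : (n <= m)%N -> nrm (u m - u n) <= 2 * K * (2^-1) ^+ n.
  move=> nm; rewrite -(subnKC nm); apply: (le_trans (hk _ _)).
  apply: ler_piMr; first by rewrite !mulr_ge0 ?exprn_ge0 ?invr_ge0.
  by rewrite lerBlDr lerDl exprn_ge0 // invr_ge0.
have cu : cvg (u @ \oo).
  apply/cauchy_cvgP/cauchyP => e e0.
  have /= eE : e = rc (cre e).
    by apply: cplx_eqP => //; move: e0; rewrite ltcE => /andP[/eqP].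
  have e0' : 0 < cre e by rewrite -rc_lt -eE.
  have e2 : 0 < cre e / 2 by rewrite divr_gt0.
  have [N hN] := half_expr_small (2 * K) e2.
  exists (u N); exists N => // m /= Nm.
  rewrite -ball_normE /= eE nrm_lt nrmB.
  apply: (le_lt_trans (hk2 _ _ Nm)); apply: (le_lt_trans (hN _ (leqnn _))); lra.
have ul : cvto u (lim (u @ \oo)).
  move=> e e0; have /cu : nbhs (lim (u @ \oo)) (fun y => nrm (lim (u @ \oo) - y) < e).
    by apply/nbhs_nrmP; exists e.
  by move=> [N _ hN]; exists N => n /hN /= /ltW; rewrite nrmB.
exists (lim (u @ \oo)) => // n; rewrite nrmB.
apply: (@cvto_le _ (fun k => u (k + n)%N - u n)); first by
  apply: cvtoD (cvto_comp_add _ ul) (cvto_cst _).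
by move=> k; apply: hk2; exact: leq_addl.
Qed.

(** The iterates of [x |-> y + B x] have increments bounded by a geometric sequence; their limit is
    a fixed point. *)
Lemma neumann (V : completeNormedModType C) (B : V -> V) :
  (forall x y, B (x - y) = B x - B y) -> (forall x, nrm (B x) <= 2^-1 * nrm x) ->
  forall y, exists x, x - B x = y.
Proof.
move=> Bl Bn y; pose u n := iter n (fun x => y + B x) 0.
have uS n : u n.+1 = y + B (u n) by [].
have hu n : nrm (u n.+1 - u n) <= nrm y * (2^-1) ^+ n.
  elim: n => [|n IH].
    rewrite expr0 uS subr0 /u /=.
    have -> : B 0 = 0 by rewrite -(subrr 0) Bl !subrr.
    by rewrite addr0 mulr1.
  have -> : u n.+2 - u n.+1 = B (u n.+1 - u n).
    by rewrite Bl !uS opprD addrACA subrr add0r.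
  rewrite exprS; have := Bn (u n.+1 - u n); lra.
have [l ul _] := geometric_cvto hu; exists l.
have uB : cvto (fun n => B (u n)) (B l).
  by apply: (cvto_lip (K := 2^-1)) ul => a b; rewrite -Bl.
have u1 : cvto (fun n => u n.+1) l by apply: cvto_ext (cvto_comp_add 1 ul) => n; rewrite addn1.
have u2 : cvto (fun n => u n.+1) (y + B l) by apply: cvtoD uB; exact: cvto_cst.
by rewrite {1}(cvto_unique u1 u2) addrK.
Qed.

End Limits.

(** * Midpoint integrals and Goursat's theorem *)

Section Squares.
Variable R : realType.
Local Notation C := (Cplx R).

Definition in_sq (x y s : R) (z : C) :=
  [/\ x <= cre z, cre z <= x + s, y <= cim z & cim z <= y + s].

(** Compactness of a square, by bisection: if [P] fails on a square it fails on a quarter of it, and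
    the failing squares shrink to a point [c] where the local hypothesis contradicts the failure. It
    serves for Goursat's theorem, for the convergence of midpoint sums and for the distance between
    closed sets. *)
Lemma square_induction (P : R -> R -> R -> Prop) :
  (forall x y s, 0 < s -> P x y (s / 2) -> P (x + s / 2) y (s / 2) ->
     P x (y + s / 2) (s / 2) -> P (x + s / 2) (y + s / 2) (s / 2) -> P x y s) ->
  (forall c : C, exists2 d, 0 < d &
     forall x y s, 0 < s -> s < d -> in_sq x y s c -> P x y s) ->
  forall x y s, 0 < s -> P x y s.
Proof.
move=> Psub Ploc x0 y0 s0 s0_gt0; apply: contrapT => nP0.
pose bad (q : R * R * R) := 0 < q.2 /\ ~ P q.1.1 q.1.2 q.2.
pose sub (q q' : R * R * R) := [/\ q'.2 = q.2 / 2, q.1.1 <= q'.1.1,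
  q'.1.1 + q'.2 <= q.1.1 + q.2, q.1.2 <= q'.1.2 & q'.1.2 + q'.2 <= q.1.2 + q.2].
(* The default [q] on squares that are not bad makes the step total, so that [choice] applies. *)
have step q : exists q', bad q -> bad q' /\ sub q q'.
  case: (pselect (bad q)) => [bq|nb]; last by exists q.
  case: q bq => [[x y] s] [/= s_gt0 nP].
  have s2 : 0 < s / 2 by lra.
  apply: contrapT => no; apply: nP; apply: Psub => //; apply: contrapT => nP;
    apply: no.
  - by exists (x, y, s / 2) => _; split; [split|split => /=; lra].
  - by exists (x + s / 2, y, s / 2) => _; split; [split|split => /=; lra].
  - by exists (x, y + s / 2, s / 2) => _; split; [split|split => /=; lra].
  - by exists (x + s / 2, y + s / 2, s / 2) => _; split; [split|split => /=; lra].
have [F hF] := choice step.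
pose q n := iter n F (x0, y0, s0).
have bq n : bad (q n) by elim: n => [|n IH] //=; have [] := hF _ IH.
have sq n : sub (q n) (q n.+1) by have [] := hF _ (bq n).
have qs n : (q n).2 = s0 * (2^-1) ^+ n.
  elim: n => [|n IH]; first by rewrite expr0 mulr1.
  by have [-> _ _ _ _] := sq n; rewrite IH exprSr mulrA.
(* Nested intervals, one coordinate at a time: the supremum of the left ends lies in all of them. *)
have mono (f : R * R * R -> R) :
    (forall n, f (q n) <= f (q n.+1) /\ f (q n.+1) + (q n.+1).2 <= f (q n) + (q n).2) ->
    exists cx, forall n, f (q n) <= cx /\ cx <= f (q n) + (q n).2.
  move=> hf.
  have up n k : f (q n) <= f (q (n + k)%N).
    elim: k => [|k IH]; first by rewrite addn0.
    by rewrite addnS (le_trans IH) //; have [] := hf (n + k)%N.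
  have dn n k : f (q (n + k)%N) + (q (n + k)%N).2 <= f (q n) + (q n).2.
    elim: k => [|k IH]; first by rewrite addn0.
    by rewrite addnS (le_trans _ IH) //; have [] := hf (n + k)%N.
  have ub n m : f (q m) <= f (q n) + (q n).2.
    apply: (le_trans (up m n)); rewrite addnC; apply: le_trans (dn n m).
    by rewrite lerDl; have [/ltW] := bq (n + m)%N.
  pose S := [set f (q m) | m in setT].
  have hS : has_sup S.
    by split; [exists (f (q 0%N)); exists 0%N | exists (f (q 0%N) + (q 0%N).2) => _ [m _ <-]].
  exists (sup S) => n; split; first by apply: sup_upper_bound => //; exists n.
  by apply: ge_sup => [|_ [m _ <-] //]; exists (f (q 0%N)); exists 0%N.
have [cx hx] := mono (fun q => q.1.1) (fun n => let: And5 _ a b _ _ := sq n in conj a b).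
have [cy hy] := mono (fun q => q.1.2) (fun n => let: And5 _ _ _ a b := sq n in conj a b).
have [d d0 hd] := Ploc (cpx cx cy).
have d2 : 0 < d / 2 by lra.
have [N /(_ N (leqnn N)) hN] := half_expr_small s0 d2.
have [pos []] := bq N; apply: hd => //; first by rewrite qs; lra.
have [h1 h2] := hx N; have [h3 h4] := hy N; by split.
Qed.

Lemma in_sq_mid x y s z w : in_sq x y s z -> in_sq x y s w -> in_sq x y s (rc 2^-1 * (z + w)).
Proof. by move=> [? ? ? ?] [? ? ? ?]; split; rewrite !cE; lra. Qed.

Lemma in_sq_dist x y s (z c : C) : in_sq x y s z -> in_sq x y s c -> nrm (z - c) <= 2 * s.
Proof.
move=> [? ? ? ?] [? ? ? ?]; apply: (le_trans (nrm_le_reim _)); rewrite !cE.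
have h (a b : R) : a <= b -> - b <= a -> `|a| <= b by move=> ? ?; rewrite ler_norml; apply/andP; split; lra.
have h1 : `|cre z - cre c| <= s by apply: h; lra.
have h2 : `|cim z - cim c| <= s by apply: h; lra.
lra.
Qed.

End Squares.

Section MidpointIntegral.
Variable R : realType.
Local Notation C := (Cplx R).

(* The midpoint rule for the integral of g from a to b, with 2^n nodes. *)
Fixpoint midint (V : lmodType C) n (g : C -> V) (a b : C) : V :=
  if n is n'.+1 then midint n' g a (rc 2^-1 * (a + b)) + midint n' g (rc 2^-1 * (a + b)) b
  else (b - a) *: g (rc 2^-1 * (a + b)).

(** Every node of [midint] arises from the end points by repeated midpoints, so this closure
    property is enough to control the integrand along a segment. *)
Definition midconvex (S : C -> Prop) := forall z w, S z -> S w -> S (rc 2^-1 * (z + w)).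

(** Seminorms are allowed because Goursat's theorem is applied to the quotient norm of [A] modulo a
    maximal ideal as well as to the norm of [C]. *)
Definition seminorm (V : lmodType C) (p : V -> R) :=
  (forall x y, p (x + y) <= p x + p y) /\ (forall a x, p (a *: x) <= nrm a * p x).

Lemma mid_diffl (a b : C) : rc 2^-1 * (a + b) - a = rc 2^-1 * (b - a).
Proof. by apply: cplx_eqP; rewrite !cE; lra. Qed.
Lemma mid_diffr (a b : C) : b - rc 2^-1 * (a + b) = rc 2^-1 * (b - a).
Proof. by apply: cplx_eqP; rewrite !cE; lra. Qed.
Lemma nrm_half (a : C) : nrm (rc 2^-1 * a) = 2^-1 * nrm a.
Proof. by rewrite nrmM nrm_rc ger0_norm // invr_ge0. Qed.

Section Lmod.
Variable V : lmodType C.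
Implicit Types g : C -> V.

Lemma eq_midint (S : C -> Prop) n g g' a b : midconvex S ->
  S a -> S b -> (forall z, S z -> g z = g' z) -> midint n g a b = midint n g' a b.
Proof.
move=> cS; elim: n a b => [|n IH] a b Sa Sb e /=; first by rewrite e //; apply: cS.
by rewrite !IH //; apply: cS.
Qed.

Lemma midint_opp n g a b : midint n g b a = - midint n g a b.
Proof.
elim: n a b => [|n IH] a b /=; first by rewrite (addrC b) -scaleNr opprB.
by rewrite (addrC b) (IH _ b) (IH a) [RHS]opprD [RHS]addrC.
Qed.

Lemma midint_lin (W : lmodType C) (L : V -> W) n g a b :
  (forall (k : C) x y, L (k *: x + y) = k *: L x + L y) ->
  L (midint n g a b) = midint n (fun z => L (g z)) a b.
Proof.
move=> Ll.
have LD x y : L (x + y) = L x + L y by have := Ll 1 x y; rewrite !scale1r.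
have L0 : L 0 = 0 by apply: (addrI (L 0)); rewrite -LD !addr0.
have LZ k x : L (k *: x) = k *: L x by have := Ll k x 0; rewrite L0 !addr0.
by elim: n a b => [|n IH] a b /=; rewrite ?LZ // LD !IH.
Qed.

Lemma midintD n g g' a b :
  midint n (fun z => g z + g' z) a b = midint n g a b + midint n g' a b.
Proof.
elim: n a b => [|n IH] a b /=; first by rewrite scalerDr.
by rewrite !IH addrACA.
Qed.

Lemma midintN n g a b : midint n (fun z => - g z) a b = - midint n g a b.
Proof.
elim: n a b => [|n IH] a b /=; first by rewrite scalerN.
by rewrite !IH opprD.
Qed.

Lemma midint_scal n (k : C -> C) (v : V) a b :
  midint n (fun z => k z *: v) a b = midint n (k : C -> C^o) a b *: v.
Proof.
elim: n a b => [|n IH] a b /=; first by rewrite scalerA.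
by rewrite !IH scalerDl.
Qed.

Lemma midint_bound (S : C -> Prop) (p : V -> R) M n g a b : midconvex S -> seminorm p ->
  S a -> S b -> (forall z, S z -> p (g z) <= M) ->
  p (midint n g a b) <= nrm (b - a) * M.
Proof.
move=> cS [pD pZ]; elim: n a b => [|n IH] a b Sa Sb hM /=.
  apply: (le_trans (pZ _ _)); rewrite ler_wpM2l ?nrm_ge0 //; apply: hM; exact: cS.
apply: (le_trans (pD _ _)).
have := IH a (rc 2^-1 * (a + b)) Sa (cS _ _ Sa Sb) hM.
have := IH (rc 2^-1 * (a + b)) b (cS _ _ Sa Sb) Sb hM.
rewrite mid_diffl mid_diffr nrm_half; lra.
Qed.

Definition hor n g x y s := midint n g (cpx x y) (cpx (x + s) y).
Definition ver n g x y s := midint n g (cpx x y) (cpx x (y + s)).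
Definition loop n g x y s := hor n g x y s + ver n g (x + s) y s - hor n g x (y + s) s - ver n g x y s.

Lemma horS n g x y s : hor n.+1 g x y s = hor n g x y (s / 2) + hor n g (x + s / 2) y (s / 2).
Proof.
rewrite /hor /=; have -> : rc 2^-1 * (cpx x y + cpx (x + s) y) = cpx (x + s / 2) y.
  by apply: cplx_eqP; rewrite !cE; lra.
by rewrite -addrA -splitr.
Qed.

Lemma verS n g x y s : ver n.+1 g x y s = ver n g x y (s / 2) + ver n g x (y + s / 2) (s / 2).
Proof.
rewrite /ver /=; have -> : rc 2^-1 * (cpx x y + cpx x (y + s)) = cpx x (y + s / 2).
  by apply: cplx_eqP; rewrite !cE; lra.
by rewrite -addrA -splitr.
Qed.

(** The nodes at level [n.+1] on a square are those at level [n] on its quarters. Each of the four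
    inner edges is run through twice, in opposite directions, and cancels as a finite sum; the
    permutation puts these four pairs last. *)
Lemma loopS n g x y s : loop n.+1 g x y s =
  loop n g x y (s / 2) + loop n g (x + s / 2) y (s / 2) +
  (loop n g x (y + s / 2) (s / 2) + loop n g (x + s / 2) (y + s / 2) (s / 2)).
Proof.
have half u : u + s / 2 + s / 2 = u + s by rewrite -addrA -splitr.
rewrite /loop !horS !verS !half !opprD [RHS](AC ((4*4)*(4*4))
  ((1*5)*(6*14)*(11*15)*(4*12)*((2*8)*(9*3)*(10*16)*(13*7)))) /=.
by rewrite !subrr !addr0.
Qed.

End Lmod.
End MidpointIntegral.

Section Goursat.
Variable R : realType.
Local Notation C := (Cplx R).
Variable V : lmodType C.
Implicit Types g : C -> V.

(** The one-node midpoint rule is exact for affine functions, so the sum around a square vanishes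
    already at level 0; subdivision propagates this. *)
Lemma loop_affine n (c : C) (u v : V) x y s : loop n (fun z => u + (z - c) *: v) x y s = 0.
Proof.
elim: n x y s => [|n IH] x y s; last by rewrite loopS !IH !addr0.
have comb (a1 a2 a3 a4 b1 b2 b3 b4 : C) :
    a1 + a2 - a3 - a4 = 0 -> a1 * b1 + a2 * b2 - a3 * b3 - a4 * b4 = 0 ->
    a1 *: (u + b1 *: v) + a2 *: (u + b2 *: v) - a3 *: (u + b3 *: v) - a4 *: (u + b4 *: v) = 0.
  move=> ea eb; rewrite !scalerDr !scalerA !opprD.
  rewrite [LHS](AC (2*2*2*2) ((1*3*5*7)*(2*4*6*8))) /=.
  by rewrite -!(scaleNr _ u) -!(scaleNr _ v) -!scalerDl ea eb !scale0r addr0.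
by apply: comb; apply: cplx_eqP; rewrite !cE; ring.
Qed.

Lemma loopD n g g' x y s : loop n (fun z => g z + g' z) x y s = loop n g x y s + loop n g' x y s.
Proof.
rewrite /loop /hor /ver !midintD !opprD.
by rewrite [LHS](AC (2*2*2*2) ((1*3*5*7)*(2*4*6*8))).
Qed.

Lemma loopN n g x y s : loop n (fun z => - g z) x y s = - loop n g x y s.
Proof. by rewrite /loop /hor /ver !midintN !opprD. Qed.

Lemma loopB n g g' x y s : loop n (fun z => g z - g' z) x y s = loop n g x y s - loop n g' x y s.
Proof. by rewrite loopD loopN. Qed.

Lemma loop_scal n (k : C -> C) (v : V) x y s :
  loop n (fun z => k z *: v) x y s = loop n (k : C -> C^o) x y s *: v.
Proof. by rewrite /loop /hor /ver !midint_scal !scalerDl !scaleNr. Qed.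

Lemma loop_lin (W : lmodType C) (L : V -> W) n g x y s :
  (forall (k : C) x y, L (k *: x + y) = k *: L x + L y) ->
  L (loop n g x y s) = loop n (fun z => L (g z)) x y s.
Proof.
move=> Ll; rewrite /loop /hor /ver -!(midint_lin _ _ _ _ Ll).
have LD u v : L (u + v) = L u + L v by have := Ll 1 u v; rewrite !scale1r.
have L0 : L 0 = 0 by apply: (addrI (L 0)); rewrite -LD !addr0.
have LN u : L (- u) = - L u by have := Ll (-1) u 0; rewrite L0 !addr0 !scaleN1r.
by rewrite !LD !LN.
Qed.

Lemma seminormN (p : V -> R) x : seminorm p -> p (- x) <= p x.
Proof. by move=> [_ pZ]; have := pZ (-1) x; rewrite scaleN1r nrmN nrm1 mul1r. Qed.

Lemma in_sq_corners (x y s : R) : 0 <= s ->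
  [/\ in_sq x y s (cpx x y), in_sq x y s (cpx (x + s) y), in_sq x y s (cpx x (y + s))
    & in_sq x y s (cpx (x + s) (y + s))].
Proof. by move=> s0; split; split; rewrite !cE; lra. Qed.

Lemma nrm_hor (x y s : R) : 0 <= s -> nrm (cpx (x + s) y - cpx x y) = s.
Proof.
move=> s0; have -> : cpx (x + s) y - cpx x y = rc s by apply: cplx_eqP; rewrite !cE; lra.
exact: nrm_rc_ge0.
Qed.

Lemma nrm_ver (x y s : R) : 0 <= s -> nrm (cpx x (y + s) - cpx x y) = s.
Proof.
move=> s0; have -> : cpx x (y + s) - cpx x y = rc s * cpx 0 1.
  by apply: cplx_eqP; rewrite !cE; lra.
by rewrite nrmM nrm_cim1 mulr1 nrm_rc_ge0.
Qed.

(** The bound on [g] is asked only on the four sides, so that a large square can be estimated from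
    the behaviour of [g] far from its centre. *)
Lemma loop_bound (p : V -> R) M n g x y s : seminorm p -> 0 <= s ->
  (forall z, in_sq x y s z -> (cre z = x \/ cre z = x + s \/ cim z = y \/ cim z = y + s) ->
     p (g z) <= M) ->
  p (loop n g x y s) <= 4 * s * M.
Proof.
move=> ps s0 hM; have [pD _] := ps.
have [c1 c2 c3 c4] := in_sq_corners x y s0.
have cvx (f : C -> R) k : (forall z w, f (rc 2^-1 * (z + w)) = 2^-1 * (f z + f w)) ->
   midconvex (fun z => in_sq x y s z /\ f z = k).
  move=> fl z w [h1 h2] [h3 h4]; split; first exact: in_sq_mid.
  by rewrite fl h2 h4; lra.
have cr (z w : C) : cre (rc 2^-1 * (z + w)) = 2^-1 * (cre z + cre w) by rewrite !cE; lra.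
have ci (z w : C) : cim (rc 2^-1 * (z + w)) = 2^-1 * (cim z + cim w) by rewrite !cE; lra.
have b1 : p (hor n g x y s) <= s * M.
  rewrite -[X in X * M](nrm_hor x y s0).
  apply: (midint_bound (S := fun z => in_sq x y s z /\ cim z = y)) => //; first exact: cvx.
  by move=> z [hz e]; apply: hM => //; right; right; left.
have b2 : p (hor n g x (y + s) s) <= s * M.
  rewrite -[X in X * M](nrm_hor x (y + s) s0).
  apply: (midint_bound (S := fun z => in_sq x y s z /\ cim z = y + s)) => //; first exact: cvx.
  by move=> z [hz e]; apply: hM => //; right; right; right.
have b3 : p (ver n g x y s) <= s * M.
  rewrite -[X in X * M](nrm_ver x y s0).
  apply: (midint_bound (S := fun z => in_sq x y s z /\ cre z = x)) => //; first exact: cvx.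
  by move=> z [hz e]; apply: hM => //; left.
have b4 : p (ver n g (x + s) y s) <= s * M.
  rewrite -[X in X * M](nrm_ver (x + s) y s0).
  apply: (midint_bound (S := fun z => in_sq x y s z /\ cre z = x + s)) => //; first exact: cvx.
  by move=> z [hz e]; apply: hM => //; right; left.
rewrite /loop.
have := pD (hor n g x y s + ver n g (x + s) y s - hor n g x (y + s) s) (- ver n g x y s).
have := pD (hor n g x y s + ver n g (x + s) y s) (- hor n g x (y + s) s).
have := pD (hor n g x y s) (ver n g (x + s) y s).
have := seminormN (ver n g x y s) ps; have := seminormN (hor n g x (y + s) s) ps; lra.
Qed.

(** Complex differentiability measured by [p]. The derivative [v] need not be unique, since [p] may
    vanish on non-zero vectors. *)
Definition pdiff (p : V -> R) g (c : C) := exists v : V, forall e : R, 0 < e ->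
  exists2 d : R, 0 < d & forall z, nrm (z - c) < d ->
    p (g z - (g c + (z - c) *: v)) <= e * nrm (z - c).

(** Bisection with an error proportional to the area. Near a point of differentiability an affine
    function can be subtracted at no cost, and what remains is small compared with the side. The
    conclusion speaks of eventual smallness under [p] and presupposes no limit in [V]. *)
Lemma goursat (p : V -> R) g x y s : seminorm p -> 0 < s ->
  (forall c, in_sq x y s c -> pdiff p g c) ->
  forall e : R, 0 < e -> exists N, forall n, (N <= n)%N -> p (loop n g x y s) <= e.
Proof.
move=> ps s0 hg e' e'0; have [pD _] := ps.
(* The allowed error is spread over the area, so that the errors of the four quarters add up to that
   of the square. *)
have [e e0 <-] : exists2 e, 0 < e & e * s ^+ 2 = e'.
  exists (e' / s ^+ 2); first by rewrite divr_gt0 // exprn_gt0.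
  by rewrite divfK // sqrf_eq0 gt_eqF.
pose P x y s := (forall c, in_sq x y s c -> pdiff p g c) ->
  exists N, forall n, (N <= n)%N -> p (loop n g x y s) <= e * s ^+ 2.
suff H : P x y s by exact: H.
move: x y s {hg e'0} s0; apply: square_induction => [x y s s0 h1 h2 h3 h4 hg|c].
  have sub x' y' : x <= x' -> x' <= x + s / 2 -> y <= y' -> y' <= y + s / 2 ->
      forall c, in_sq x' y' (s / 2) c -> pdiff p g c.
    by move=> ? ? ? ? c [? ? ? ?]; apply: hg; split; lra.
  have [|N1 k1] := h1; first by apply: sub; lra.
  have [|N2 k2] := h2; first by apply: sub; lra.
  have [|N3 k3] := h3; first by apply: sub; lra.
  have [|N4 k4] := h4; first by apply: sub; lra.
  (* The successor pays for the level lost in passing to the quarters. *)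
  exists (maxn (maxn N1 N2) (maxn N3 N4)).+1 => -[//|n].
  rewrite ltnS !geq_max => /andP[/andP[/k1 l1 /k2 l2] /andP[/k3 l3 /k4 l4]].
  rewrite loopS; apply: (le_trans (pD _ _)).
  apply: (le_trans (lerD (pD _ _) (pD _ _))).
  have -> : e * s ^+ 2 = 4 * (e * (s / 2) ^+ 2) by field.
  lra.
have [hc|nc] := pselect (pdiff p g c); last first.
  by exists 1 => // x y s _ _ cs hg; case: nc; exact: hg.
have [v hv] := hc.
(* On the square [nrm (z - c)] is at most [2 * s] and the perimeter is [4 * s], hence the factor
   8. *)
have e8 : 0 < e / 8 by lra.
have [d d0 hd] := hv _ e8; exists (d / 2); first by lra.
move=> x y s s0 sd cs _; exists 0%N => n _.
have -> : loop n g x y s = loop n (fun z => g z - (g c + (z - c) *: v)) x y s.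
  by rewrite loopB loop_affine subr0.
have -> : e * s ^+ 2 = 4 * s * (e / 8 * (2 * s)) by field.
apply: loop_bound => //; first exact: ltW.
move=> z zs _; have zc := in_sq_dist zs cs.
have /hd h : nrm (z - c) < d by lra.
by apply: (le_trans h); rewrite ler_wpM2l // ltW.
Qed.

End Goursat.

(** * Midpoint sums of a simple pole around a square *)

Section Pole.
Variable R : realType.
Local Notation C := (Cplx R).

Definition pole (l : C) : C -> C^o := fun z => (z - l)^-1.

Lemma cpxV (r t : R) : 0 < r -> (cpx r t)^-1 = cpx (r / (r ^+ 2 + t ^+ 2)) (- t / (r ^+ 2 + t ^+ 2)).
Proof.
move=> r0; have D0 : 0 < r ^+ 2 + t ^+ 2 by rewrite ltr_wpDr ?sqr_ge0 ?exprn_gt0.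
have z0 : cpx r t != 0.
  by apply/eqP => /(congr1 (@cre R)); rewrite !cE => e; rewrite e ltxx in r0.
apply: (mulfI z0); rewrite mulfV //; apply: cplx_eqP; rewrite !cE; field;
  by rewrite gt_eqF.
Qed.

(** With z = l + om (r + i t) one has dz / (z - l) = i dt / (r + i t), whose imaginary part r / (r^2
    + t^2) is at least 1 / (2 r) for |t| <= r. The estimate holds node by node, hence for the
    midpoint sums themselves. The factor [om] turns the segment into any side of the square centred
    at [l]. *)
Lemma pole_segment n (l om : C) (r t1 t2 : R) : om != 0 -> 0 < r ->
  - r <= t1 -> t1 <= t2 -> t2 <= r ->
  (t2 - t1) / (2 * r) <= cim (midint n (pole l) (l + om * cpx r t1) (l + om * cpx r t2)).
Proof.
move=> om0 r0; elim: n t1 t2 => [|n IH] t1 t2 h1 h12 h2 /=; last first.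
  have -> : rc 2^-1 * (l + om * cpx r t1 + (l + om * cpx r t2)) = l + om * cpx r ((t1 + t2) / 2).
    by apply: cplx_eqP; rewrite !cE; field.
  have := IH t1 ((t1 + t2) / 2); have := IH ((t1 + t2) / 2) t2.
  rewrite !cE => k1 k2.
  have : (t2 - (t1 + t2) / 2) / (2 * r) + ((t1 + t2) / 2 - t1) / (2 * r) = (t2 - t1) / (2 * r).
    by field; lra.
  have := k1 ltac:(lra) ltac:(lra) ltac:(lra); have := k2 ltac:(lra) ltac:(lra) ltac:(lra).
  lra.
set t := (t1 + t2) / 2.
have -> : l + om * cpx r t2 - (l + om * cpx r t1) = om * cpx 0 (t2 - t1).
  by apply: cplx_eqP; rewrite !cE; ring.
rewrite /pole.
have -> : rc 2^-1 * (l + om * cpx r t1 + (l + om * cpx r t2)) - l = om * cpx r t.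
  by apply: cplx_eqP; rewrite !cE /t; field.
have scE (a : C) (b : C^o) : a *: b = (a * b : C) by [].
rewrite scE (invfM om) mulrACA mulfV // mul1r cpxV // !cE mul0r add0r.
have t2r : t ^+ 2 <= r ^+ 2 by rewrite /t; nra.
have D0 : 0 < r ^+ 2 + t ^+ 2 by rewrite ltr_wpDr ?sqr_ge0 ?exprn_gt0.
rewrite ler_wpM2l ?subr_ge0 // ler_pdivlMr // mulrC ler_pdivrMr ?mulr_gt0 //.
by rewrite !expr2 in t2r *; nra.
Qed.

Definition grd (a : R) (s : R) (i : nat) := a + i%:R * s.

Lemma grdS a (t : R) i : grd a t i.+1 = grd a t i + t.
Proof. by rewrite /grd -natr1 mulrDl mul1r addrA. Qed.

(** The cells tile the square of half-side [r] centred at [l]. The exact integral is 2 i pi; the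
    cruder bound 4 counts 1 for each side and is valid at every level [n]. *)
Lemma grid_pole n N (l : C) (r : R) : 0 < r ->
  let s := 2 * r / N.+1%:R in
  4 <= cim (\sum_(i < N.+1) \sum_(j < N.+1)
     loop n (pole l) (grd (cre l - r) s i) (grd (cim l - r) s j) s).
Proof.
move=> r0 /=; set t := 2 * r / _; set X := grd (cre l - r) t; set Y := grd (cim l - r) t.
have N0 : (0 : R) < N.+1%:R by rewrite ltr0n.
have tN : N.+1%:R * t = 2 * r by rewrite /t mulrCA divff ?gt_eqF // mulr1.
have t0 : 0 < t by rewrite divr_gt0 // mulr_gt0.
have XN : X N.+1 = cre l + r by rewrite /X /grd tN; lra.
have YN : Y N.+1 = cim l + r by rewrite /Y /grd tN; lra.
have rng i : (i < N.+1)%N -> 0 <= i%:R * t /\ i%:R * t + t <= 2 * r.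
  move=> iN; split; first by rewrite mulr_ge0 ?ler0n // ltW.
  have : i%:R + 1 <= (N.+1%:R : R) by rewrite natr1 ler_nat.
  by move=> /(ler_wpM2r (ltW t0)); rewrite tN mulrDl mul1r.
(* Telescoping along columns and rows leaves only the outer frame. The cancellation is formal, so
   [l] may lie on an inner edge. *)
have e : \sum_(i < N.+1) \sum_(j < N.+1) loop n (pole l) (X i) (Y j) t =
  \sum_(i < N.+1) (hor n (pole l) (X i) (Y 0%N) t - hor n (pole l) (X i) (Y N.+1) t) +
  \sum_(j < N.+1) (ver n (pole l) (X N.+1) (Y j) t - ver n (pole l) (X 0%N) (Y j) t).
  have tel (f : nat -> C^o) : \sum_(j < N.+1) (f j.+1 - f j) = f N.+1 - f 0%N.
    by rewrite -(big_mkord predT (fun j => f j.+1 - f j)) telescope_sumr.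
  have tel' (f : nat -> C^o) : \sum_(j < N.+1) (f j - f j.+1) = f 0%N - f N.+1.
    by rewrite -[RHS]opprB -tel -sumrN; apply: eq_bigr => i _; rewrite opprB.
  pose h i j := hor n (pole l) (X i) (Y j) t; pose v i j := ver n (pole l) (X i) (Y j) t.
  transitivity (\sum_(i < N.+1) \sum_(j < N.+1) ((h i j - h i j.+1) + (v i.+1 j - v i j))).
    apply: eq_bigr => i _; apply: eq_bigr => j _.
    by rewrite /loop -[X i + t]grdS -[Y j + t]grdS [LHS](AC 4 ((1*3)*(2*4))).
  transitivity (\sum_(i < N.+1) (h i 0%N - h i N.+1) +
      \sum_(i < N.+1) \sum_(j < N.+1) (v i.+1 j - v i j)).
    by rewrite -big_split; apply: eq_bigr => i _; rewrite big_split -(tel' (h i)).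
  congr (_ + _); rewrite exchange_big /=; apply: eq_bigr => j _.
  by rewrite (tel (v^~ j)).
rewrite e.
(* A cell gives [t / (2 * r)] on each of two opposite sides; the cells have total length [2 * r], so
   each pair of sides gives 2. *)
have bound (f : nat -> C^o) : (forall i, (i < N.+1)%N -> t / r <= cim (f i)) ->
    2 <= cim (\sum_(i < N.+1) f i).
  move=> hf; have -> : 2 = \sum_(i < N.+1) (t / r).
    by rewrite sumr_const card_ord -[RHS]mulr_natl [RHS]mulrA tN; field; lra.
  have -> : cim (\sum_(i < N.+1) f i) = \sum_(i < N.+1) cim (f i).
    by apply: (big_morph (@cim R)) => // a b; rewrite cimD.
  by apply: ler_sum => i _; apply: hf.
rewrite cimD; have -> : (4 : R) = 2 + 2 by lra.
have ee : t / r = t / (2 * r) + t / (2 * r) by field; lra.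
(* The factor [om] is -i, i, 1 and -1 on the bottom, top, right and left side; the top and left
   sides are reversed to match the orientation of the frame. *)
have P1 : (cpx 0 1 : C) != 0.
  by apply/eqP => /(congr1 (@cim R)); rewrite !cE => /eqP; rewrite oner_eq0.
have P2 : (cpx 0 (-1) : C) != 0.
  by apply/eqP => /(congr1 (@cim R)); rewrite !cE => /eqP; rewrite oppr_eq0 oner_eq0.
apply: lerD.
- apply: (bound (fun i => hor n (pole l) (X i) (Y 0%N) t - hor n (pole l) (X i) (Y N.+1) t)).
  move=> i /rng[i0 i1]; rewrite ee cimD.
  apply: lerD; last rewrite -midint_opp.
  + have := @pole_segment n l (cpx 0 (-1)) r (i%:R * t - r) (i%:R * t + t - r) P2 r0.
    have -> : i%:R * t + t - r - (i%:R * t - r) = t by ring.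
    move=> /(_ ltac:(lra) ltac:(lra) ltac:(lra)).
    congr (is_true (_ <= cim (midint n (pole l) _ _))).
    * by apply: cplx_eqP; rewrite !cE /X /Y /grd; ring.
    * by apply: cplx_eqP; rewrite !cE /X /Y /grd; ring.
  + have := @pole_segment n l (cpx 0 1) r (r - (i%:R * t + t)) (r - i%:R * t) P1 r0.
    have -> : r - i%:R * t - (r - (i%:R * t + t)) = t by ring.
    move=> /(_ ltac:(lra) ltac:(lra) ltac:(lra)).
    congr (is_true (_ <= cim (midint n (pole l) _ _))).
    * by apply: cplx_eqP; rewrite YN !cE /X /grd; ring.
    * by apply: cplx_eqP; rewrite YN !cE /X /grd; ring.
- apply: (bound (fun j => ver n (pole l) (X N.+1) (Y j) t - ver n (pole l) (X 0%N) (Y j) t)).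
  move=> i /rng[i0 i1]; rewrite ee cimD.
  apply: lerD; last rewrite -midint_opp.
  + have := @pole_segment n l 1 r (i%:R * t - r) (i%:R * t + t - r) (oner_neq0 _) r0.
    have -> : i%:R * t + t - r - (i%:R * t - r) = t by ring.
    move=> /(_ ltac:(lra) ltac:(lra) ltac:(lra)).
    congr (is_true (_ <= cim (midint n (pole l) _ _))).
    * by apply: cplx_eqP; rewrite XN !cE /Y /grd; ring.
    * by apply: cplx_eqP; rewrite XN !cE /Y /grd; ring.
  + have := @pole_segment n l (-1) r (r - (i%:R * t + t)) (r - i%:R * t) ltac:(by rewrite oppr_eq0 oner_eq0) r0.
    have -> : r - i%:R * t - (r - (i%:R * t + t)) = t by ring.
    move=> /(_ ltac:(lra) ltac:(lra) ltac:(lra)).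
    congr (is_true (_ <= cim (midint n (pole l) _ _))).
    * by apply: cplx_eqP; rewrite !cE /X /Y /grd; ring.
    * by apply: cplx_eqP; rewrite !cE /X /Y /grd; ring.
Qed.

End Pole.

(** * Summation by parts over a grid of squares *)

Section Grid.
Variable R : realType.
Local Notation C := (Cplx R).
Variable V : lmodType C.

Lemma abel_sum (c : nat -> C) (v : nat -> V) N :
  \sum_(i < N.+1) c i *: (v i.+1 - v i) =
  c N *: v N.+1 - c 0%N *: v 0%N + \sum_(i < N) (c i - c i.+1) *: v i.+1.
Proof.
elim: N => [|N IH]; first by rewrite big_ord_recr !big_ord0 /= add0r addr0 scalerBr.
rewrite big_ord_recr IH [in RHS]big_ord_recr /= scalerBr scalerBl.
set S := \sum_(i < N) _.
by rewrite [RHS](AC (2*(1*2)) ((4*2)*3*(1*5))).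
Qed.

Variable Pd : (nat -> V) -> Prop.
Hypothesis PdD : forall u v, Pd u -> Pd v -> Pd (fun n => u n + v n).
Hypothesis PdZ : forall (k : C) u, Pd u -> Pd (fun n => k *: u n).
Hypothesis Pd0 : Pd (fun=> 0).

Lemma Pd_sum N (u : nat -> nat -> V) : (forall i, (i < N)%N -> Pd (u i)) ->
  Pd (fun n => \sum_(i < N) u i n).
Proof.
elim: N => [|N IH] h; first by under eq_fun do rewrite big_ord0.
under eq_fun do rewrite big_ord_recr /=.
by apply: PdD (h _ (ltnSn _)); apply: IH => i iN; apply: h; exact: ltnW.
Qed.

Lemma abel_closed (c : nat -> C) (v : nat -> nat -> V) N :
  (c 0%N != 0 -> Pd (v 0%N)) -> (c N != 0 -> Pd (v N.+1)) ->
  (forall i, (i < N)%N -> c i != c i.+1 -> Pd (v i.+1)) ->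
  Pd (fun n => \sum_(i < N.+1) c i *: (v i.+1 n - v i n)).
Proof.
move=> h0 hN hi; under eq_fun do rewrite (abel_sum c (fun i => v i _)).
have Z (k : C) u : (k != 0 -> Pd u) -> Pd (fun n => k *: u n).
  by have [->|k0 /(_ isT)] := eqVneq k 0; [under eq_fun do rewrite scale0r | exact: PdZ].
apply: PdD; first apply: PdD; first exact: Z.
  by under eq_fun do rewrite -scaleNr; apply: Z; rewrite oppr_eq0.
apply: (Pd_sum (u := fun i n => (c i - c i.+1) *: v i.+1 n)) => i iN.
by apply: Z; rewrite subr_eq0; exact: hi.
Qed.

(** After summation by parts an edge carries the difference of the coefficients of its two squares,
    and edges where this difference is zero impose no condition on [g]. The property [Pd] is left
    abstract because it is used both for convergence and for identical vanishing. *)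
Lemma grid_closed (g : C -> V) (c : nat -> nat -> C) N x0 y0 s :
  (forall i, (i <= N)%N ->
    [/\ c i 0%N != 0 -> Pd (fun n => hor n g (grd x0 s i) y0 s),
        c i N != 0 -> Pd (fun n => hor n g (grd x0 s i) (grd y0 s N.+1) s)
      & forall j, (j < N)%N -> c i j != c i j.+1 ->
          Pd (fun n => hor n g (grd x0 s i) (grd y0 s j.+1) s)]) ->
  (forall j, (j <= N)%N ->
    [/\ c 0%N j != 0 -> Pd (fun n => ver n g x0 (grd y0 s j) s),
        c N j != 0 -> Pd (fun n => ver n g (grd x0 s N.+1) (grd y0 s j) s)
      & forall i, (i < N)%N -> c i j != c i.+1 j ->
          Pd (fun n => ver n g (grd x0 s i.+1) (grd y0 s j) s)]) ->
  Pd (fun n => \sum_(i < N.+1) \sum_(j < N.+1) c i j *: loop n g (grd x0 s i) (grd y0 s j) s).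
Proof.
move=> hh hv.
have -> : (fun n => \sum_(i < N.+1) \sum_(j < N.+1) c i j *: loop n g (grd x0 s i) (grd y0 s j) s) =
  (fun n => -1 *: (\sum_(i < N.+1) \sum_(j < N.+1) c i j *: (hor n g (grd x0 s i) (grd y0 s j.+1) s - hor n g (grd x0 s i) (grd y0 s j) s)) +
    \sum_(j < N.+1) \sum_(i < N.+1) c i j *: (ver n g (grd x0 s i.+1) (grd y0 s j) s - ver n g (grd x0 s i) (grd y0 s j) s)).
  apply/funext => n; rewrite [X in _ + X]exchange_big /= scaler_sumr -big_split /=.
  apply: eq_bigr => i _; rewrite scaler_sumr -big_split /=; apply: eq_bigr => j _.
  rewrite scalerA mulN1r scaleNr -scalerN -scalerDr !grdS /loop; congr (_ *: _).
  by rewrite opprB [LHS](AC 4 ((1*3)*(2*4))).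
have g0 a : grd a s 0 = a by rewrite /grd mul0r addr0.
apply: PdD; first apply: PdZ.
  apply: (Pd_sum (u := fun i n => \sum_(j < N.+1) c i j *: (hor n g (grd x0 s i) (grd y0 s j.+1) s - hor n g (grd x0 s i) (grd y0 s j) s))) => i iN; have [h1 h2 h3] := hh i iN.
  by apply: (abel_closed (v := fun j n => hor n g (grd x0 s i) (grd y0 s j) s)) => //; rewrite g0.
apply: (Pd_sum (u := fun j n => \sum_(i < N.+1) c i j *: (ver n g (grd x0 s i.+1) (grd y0 s j) s - ver n g (grd x0 s i) (grd y0 s j) s))) => j jN; have [h1 h2 h3] := hv j jN.
by apply: (abel_closed (c := fun i => c i j) (v := fun i n => ver n g (grd x0 s i) (grd y0 s j) s)) => //; rewrite g0.
Qed.

End Grid.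

(** * Convergence of midpoint sums and distance between closed sets *)

Section MidpointConvergence.
Variable R : realType.
Local Notation C := (Cplx R).
Variable V : completeNormedModType C.

Definition loclip (g : C -> V) (c : C) := exists2 d : R, 0 < d & exists M : R,
  forall z z', nrm (z - c) < d -> nrm (z' - c) < d -> nrm (g z - g z') <= M * nrm (z - z').

Lemma ball_midconvex (c : C) (d : R) : midconvex (fun z => nrm (z - c) < d).
Proof.
move=> z w zd wd.
have -> : rc 2^-1 * (z + w) - c = rc 2^-1 * (z - c) + rc 2^-1 * (w - c).
  by apply: cplx_eqP; rewrite !cE; lra.
apply: (le_lt_trans (nrmD _ _)); rewrite !nrm_half; lra.
Qed.

(** Splitting an interval of length D moves its node by D / 4 and so changes the sum by at most M
    D^2 / 4. At level [n] there are 2^n intervals of length D / 2^n, which gives the factor 2^-n. *)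
Lemma midint_step_bound (g : C -> V) (S : C -> Prop) (M : R) n a b : midconvex S -> 0 <= M ->
  (forall z z', S z -> S z' -> nrm (g z - g z') <= M * nrm (z - z')) -> S a -> S b ->
  nrm (midint n.+1 g a b - midint n g a b) <= M * nrm (b - a) ^+ 2 * (2^-1) ^+ n.
Proof.
move=> cS M0 hg; elim: n a b => [|n IH] a b Sa Sb.
  have Sm := cS _ _ Sa Sb; have Sm1 := cS _ _ Sa Sm; have Sm2 := cS _ _ Sm Sb.
  rewrite /=; set m := rc 2^-1 * (a + b) in Sm Sm1 Sm2 *.
  set m1 := rc 2^-1 * (a + m) in Sm1 *; set m2 := rc 2^-1 * (m + b) in Sm2 *.
  have -> : (m - a) *: g m1 + (b - m) *: g m2 - (b - a) *: g m =
      (rc 2^-1 * (b - a)) *: (g m1 - g m) + (rc 2^-1 * (b - a)) *: (g m2 - g m).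
    rewrite mid_diffl mid_diffr !scalerBr [RHS]addrACA -opprD -(scalerDl (g m)).
    by congr (_ - _ *: _); apply: cplx_eqP; rewrite !cE; lra.
  apply: (le_trans (nrmD _ _)); rewrite !(nrmZ _ (_ - g m)) nrm_half.
  have e1 : m1 - m = rc (- 4^-1) * (b - a) by apply: cplx_eqP; rewrite !cE; lra.
  have e2 : m2 - m = rc 4^-1 * (b - a) by apply: cplx_eqP; rewrite !cE; lra.
  have n4 : `|4^-1 : R| = 4^-1 by rewrite ger0_norm // invr_ge0.
  have := hg _ _ Sm1 Sm; rewrite e1 nrmM nrm_rc normrN n4 => h1.
  have := hg _ _ Sm2 Sm; rewrite e2 nrmM nrm_rc n4 => h2.
  have D0 := nrm_ge0 (b - a); rewrite expr0 mulr1 expr2.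
  move: (nrm (b - a)) (nrm (g m1 - g m)) (nrm (g m2 - g m)) h1 h2 D0 => D p q h1 h2 D0.
  have := ler_wpM2l D0 h1; have := ler_wpM2l D0 h2.
  have : 0 <= D * (M * D) by rewrite !mulr_ge0.
  lra.
have Sm := cS _ _ Sa Sb; rewrite -[midint n.+2 _ _ _]/(midint n.+1 g a _ + midint n.+1 g _ b).
rewrite -[in X in _ - X]/(midint n.+1 g a b) [in X in _ - X]/= opprD addrACA.
apply: (le_trans (nrmD _ _)); apply: (le_trans (lerD (IH _ _ Sa Sm) (IH _ _ Sm Sb))).
rewrite mid_diffl mid_diffr nrm_half (exprS _ n) !expr2; lra.
Qed.

(** Lipschitz bounds are available only locally, so the segment is bisected until each piece lies in
    one of these neighbourhoods; there the sums converge geometrically. *)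
Lemma midint_cvto (g : C -> V) (a b : C) :
  (forall t : R, 0 <= t -> t <= 1 -> loclip g (a + rc t * (b - a))) ->
  exists l, cvto (fun n => midint n g a b) l.
Proof.
move=> hg; pose ga (t : R) := a + rc t * (b - a).
(* The parameter interval is the first side of a square whose second coordinate is idle. *)
pose P (x y s : R) := 0 <= x -> x + s <= 1 ->
  exists l, cvto (fun n => midint n g (ga x) (ga (x + s))) l.
suff H : P 0 0 1.
  have [||l hl] := H; [by []|by rewrite add0r|].
  have e0 : ga 0 = a by rewrite /ga rc0 mul0r addr0.
  have e1 : ga 1 = b by rewrite /ga rc1 mul1r subrKC.
  by exists l; move: hl; rewrite add0r e0 e1.
apply: square_induction => // [x y s s0 h1 h2 _ _ x0 xs|c].
  have [||l1 hl1] := h1; [lra|lra|].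
  have [||l2 hl2] := h2; [lra|lra|].
  exists (l1 + l2); apply: cvto_shift.
  apply: cvto_ext (cvtoD hl1 hl2) => n /=.
  have -> : rc 2^-1 * (ga x + ga (x + s)) = ga (x + s / 2).
    by apply: cplx_eqP; rewrite !cE; lra.
  by rewrite -(addrA x) -splitr.
(* A centre with real part outside [0, 1] lies in no square over a parameter subinterval; the radius
   1 is arbitrary. *)
have [c01|nc] := pselect (0 <= cre c /\ cre c <= 1); last first.
  by exists 1 => // x y s s0 _ [? ? ? ?] x0 xs; case: nc; split; lra.
have [d d0 [M hM]] := hg _ c01.1 c01.2.
have D0 := nrm_ge0 (b - a); have D1 : 0 < nrm (b - a) + 1 by lra.
exists (d / (nrm (b - a) + 1)); first by rewrite divr_gt0.
move=> x y s s0 sd [cx cxs _ _] x0 xs.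
have inb t : x <= t -> t <= x + s -> nrm (ga t - ga (cre c)) < d.
  move=> xt ts; have -> : ga t - ga (cre c) = rc (t - cre c) * (b - a).
    by apply: cplx_eqP; rewrite !cE; ring.
  rewrite nrmM nrm_rc; apply: (@le_lt_trans _ _ (s * (nrm (b - a) + 1))).
    apply: ler_pM => //; last by lra.
    by rewrite ler_norml; apply/andP; split; lra.
  by rewrite -ltr_pdivlMr.
have M0 : 0 <= `|M| by [].
have hM' z z' : nrm (z - ga (cre c)) < d -> nrm (z' - ga (cre c)) < d ->
    nrm (g z - g z') <= `|M| * nrm (z - z').
  by move=> h1 h2; apply: (le_trans (hM _ _ h1 h2)); rewrite ler_wpM2r ?nrm_ge0 ?ler_norm.
have [|l hl _] := @geometric_cvto R V (fun n => midint n g (ga x) (ga (x + s)))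
   (`|M| * nrm (ga (x + s) - ga x) ^+ 2); last by exists l.
move=> n; apply: midint_step_bound (@ball_midconvex (ga (cre c)) d) M0 hM' _ _.
  by apply: inb; lra.
by apply: inb; lra.
Qed.

(** The two hypotheses on complements say that [K] and [L] are closed. A minimum of distances over
    four quarters is still positive, and near a point at least one of the two sets stays away. *)
Lemma set_separation (K L : set C) x y s : 0 < s ->
  (forall z, ~ K z -> exists2 e : R, 0 < e & forall z', nrm (z - z') < e -> ~ K z') ->
  (forall z, ~ L z -> exists2 e : R, 0 < e & forall z', nrm (z - z') < e -> ~ L z') ->
  (forall z, K z -> ~ L z) ->
  exists2 d : R, 0 < d & forall p q, K p -> in_sq x y s p -> L q -> d <= nrm (p - q).
Proof.
move=> s0 cK cL KL; pose P x y s := exists2 d : R, 0 < d &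
  forall p q : C, K p -> in_sq x y s p -> L q -> d <= nrm (p - q).
suff H : P x y s by exact: H.
move: x y s s0; apply: square_induction.
  move=> x y s s0 [d1 d10 h1] [d2 d20 h2] [d3 d30 h3] [d4 d40 h4].
  exists (Num.min (Num.min d1 d2) (Num.min d3 d4)); first by rewrite !lt_min d10 d20 d30 d40.
  move=> p q Kp [px1 px2 py1 py2] Lq; rewrite !ge_min.
  have [hx|/ltW hx] := leP (cre p) (x + s / 2); have [hy|/ltW hy] := leP (cim p) (y + s / 2).
  - by rewrite h1 //; split; lra.
  - by rewrite [d3 <= _]h3 ?orbT //; split; lra.
  - by rewrite [d2 <= _]h2 ?orbT //; split; lra.
  - by rewrite [d4 <= _]h4 ?orbT //; split; lra.
move=> c; have [Kc|nKc] := pselect (K c); last first.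
  have [e e0 he] := cK _ nKc; exists (e / 2); first by lra.
  move=> x y s s0 se cs; exists 1 => // p q Kp ps _.
  have := in_sq_dist cs ps => h; case: (he p) => //; lra.
have [e e0 he] := cL _ (KL _ Kc); exists (e / 4); first by lra.
move=> x y s s0 se cs; exists (e / 2); first by lra.
move=> p q _ ps Lq; have h := in_sq_dist cs ps.
have : e <= nrm (c - q) by rewrite leNgt; apply/negP => /he.
have := nrm_trans p c q; lra.
Qed.

End MidpointConvergence.

(** * The closed graph theorem *)

Section ClosedGraph.
Variable R : realType.
Local Notation C := (Cplx R).
Variables V W : completeNormedModType C.
Variable L : V -> W.
Hypothesis Llin : forall (k : C) x y, L (k *: x + y) = k *: L x + L y.
Hypothesis Lclosed : forall u l m, cvto u l -> cvto (fun n => L (u n)) m -> m = L l.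

Let LD x y : L (x + y) = L x + L y. Proof. by have := Llin 1 x y; rewrite !scale1r. Qed.
Let L0 : L 0 = 0. Proof. by apply: (addrI (L 0)); rewrite -LD !addr0. Qed.
Let LZ k x : L (k *: x) = k *: L x. Proof. by have := Llin k x 0; rewrite L0 !addr0. Qed.
Let LB x y : L (x - y) = L x - L y. Proof. by rewrite LD -scaleN1r LZ scaleN1r. Qed.

(** Baire's argument in place: some set of points with [nrm (L a) <= n] is dense in a ball.
    Otherwise there are nested balls with [L] larger than [k] on the [k]-th new one, and at their
    common point [nrm (L l)] exceeds every integer. *)
Lemma closed_graph_baire : exists (n : nat) x0, exists2 r : R, 0 < r &
  forall y, nrm (y - x0) < r -> forall e : R, 0 < e -> exists2 a, nrm (y - a) < e & nrm (L a) <= n%:R.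
Proof.
apply: contrapT => no.
(* Closed balls as pairs of centre and radius: the new ball lies in the old one, and [L] exceeds [k]
   on it. *)
pose sub (k : nat) (q q' : V * R) := [/\ 0 < q'.2, q'.2 <= q.2 / 2,
   nrm (q'.1 - q.1) + q'.2 <= q.2 & forall a, nrm (q'.1 - a) <= q'.2 -> k%:R < nrm (L a)].
have step (kq : nat * (V * R)) : exists q', 0 < kq.2.2 -> sub kq.1 kq.2 q'.
  case: kq => k [x r] /=; have [r0|nr] := pselect (0 < r); last by exists (x, r).
  have [y [yr [e e0 he]]] : exists y, nrm (y - x) < r /\ exists2 e : R, 0 < e &
      forall a, nrm (y - a) < e -> k%:R < nrm (L a).
    apply: contrapT => nn; apply: no; exists k, x, r => // y yr e e0.
    apply: contrapT => na; apply: nn; exists y; split => //; exists e => // a ya.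
    by rewrite ltNge; apply/negP => La; apply: na; exists a.
  have m0 : 0 < Num.min (e / 2) (Num.min (r / 2) (r - nrm (y - x))) by rewrite !lt_min; lra.
  exists (y, Num.min (e / 2) (Num.min (r / 2) (r - nrm (y - x)))) => _; split => //=.
  - by rewrite !ge_min lexx orbT.
  - have : Num.min (e / 2) (Num.min (r / 2) (r - nrm (y - x))) <= r - nrm (y - x).
      by rewrite !ge_min lexx !orbT.
    lra.
  - move=> a ya; apply: he; apply: (le_lt_trans ya).
    by rewrite !gt_min; apply/orP; left; lra.
have [F hF] := choice step.
pose q := fix q n := if n is k.+1 then F (k, q k) else ((0 : V), (1 : R)).
have q0 n : 0 < (q n).2 by elim: n => [|n IH] //=; have [] := hF (n, q n) IH.
have sq n : sub n (q n) (q n.+1) by exact: (hF (n, q n) (q0 n)).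
have qr n : (q n).2 <= (2^-1) ^+ n.
  elim: n => [|n IH]; first by rewrite expr0.
  by have [_ h _ _] := sq n; rewrite exprSr; lra.
have [l hl _] : exists2 l, cvto (fun n => (q n).1) l & forall n, nrm ((q n).1 - l) <= 2 * 1 * (2^-1) ^+ n.
  apply: geometric_cvto => n; rewrite mul1r; apply: le_trans (qr n).
  by have [h1 _ h2 _] := sq n; lra.
have nest k m : nrm ((q (m + k)%N).1 - (q k).1) + (q (m + k)%N).2 <= (q k).2.
  elim: m => [|m IH]; first by rewrite add0n subrr nrm0 add0r.
  have [_ _ h _] := sq (m + k)%N; rewrite addSn.
  have := nrm_trans (q (m + k)%N).1 (q (m + k).+1).1 (q k).1; lra.
have lk k : nrm ((q k).1 - l) <= (q k).2.
  rewrite nrmB; apply: (@cvto_le _ _ (fun m => (q (m + k)%N).1 - (q k).1)).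
    by apply: cvtoD (cvto_comp_add _ hl) (cvto_cst _).
  by move=> m; have := nest k m; have := q0 (m + k)%N; lra.
have big k : k%:R < nrm (L l) by have [_ _ _ h] := sq k; apply: h; exact: lk.
have := big (Num.bound (nrm (L l))); rewrite ltNge ltW // archi_boundP //.
exact: nrm_ge0.
Qed.

(** Writing y as half the difference of x0 + y and x0 - y moves the ball of density to the origin.
    Scaling y to norm r / 2 and approximating it within r / 4 gives the relative error 1/2. *)
Lemma closed_graph_approx : exists2 K : R, 0 <= K & forall y, exists2 a,
  nrm (y - a) <= 2^-1 * nrm y & nrm (L a) <= K * nrm y.
Proof.
have [n [x0 [r r0 hr]]] := closed_graph_baire.
have r2 : 0 < r / 2 by lra.
have small y : nrm y < r -> forall e : R, 0 < e -> exists2 a, nrm (y - a) < e & nrm (L a) <= n%:R.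
  move=> yr e e0.
  have [||a1 h1 k1] := hr (x0 + y) _ e _ => //; first by rewrite addrC addKr.
  have [||a2 h2 k2] := hr (x0 - y) _ e _ => //; first by rewrite addrC addKr nrmN.
  exists (rc 2^-1 *: (a1 - a2)).
    have -> : y - rc 2^-1 *: (a1 - a2) = rc 2^-1 *: ((x0 + y - a1) - (x0 - y - a2)).
      have -> : (x0 + y - a1) - (x0 - y - a2) = (y + y) - (a1 - a2).
        rewrite !opprD !opprK [LHS](AC (3*3) ((1*4)*((2*5)*(3*6)))) /=.
        by rewrite subrr add0r.
      have hh : rc 2^-1 + rc 2^-1 = 1 :> C by apply: cplx_eqP; rewrite !cE; lra.
      by rewrite [RHS]scalerBr (scalerDr _ y) -scalerDl hh scale1r.
    rewrite nrmZ nrm_rc ger0_norm ?invr_ge0 //.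
    have := nrmBD (x0 + y - a1) (x0 - y - a2); lra.
  rewrite LZ LB nrmZ nrm_rc ger0_norm ?invr_ge0 //; have := nrmBD (L a1) (L a2); lra.
exists (n%:R / (r / 2)); first by rewrite divr_ge0 // ltW.
move=> y; have [->|y0] := eqVneq y 0.
  by exists 0; rewrite ?L0 ?subrr !nrm0 mulr0.
have ny := nrm_pos y0.
have k0 : 0 < r / 2 / nrm y by rewrite divr_gt0.
have nk : nrm (rc (r / 2 / nrm y)) = r / 2 / nrm y by rewrite nrm_rc_ge0 // ltW.
have kk : rc (r / 2 / nrm y) != 0.
  by apply/eqP => /(congr1 (@cre R)); rewrite !cE => h; rewrite h ltxx in k0.
have [|a ha La] := small (rc (r / 2 / nrm y) *: y) _ (r / 4) ltac:(lra).
  by rewrite nrmZ nk divfK ?gt_eqF //; lra.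
exists ((rc (r / 2 / nrm y))^-1 *: a).
  have -> : y - (rc (r / 2 / nrm y))^-1 *: a = (rc (r / 2 / nrm y))^-1 *: (rc (r / 2 / nrm y) *: y - a).
    by rewrite scalerBr scalerA mulVf // scale1r.
  rewrite nrmZ nrmV nk; apply: (@le_trans _ _ ((r / 2 / nrm y)^-1 * (r / 4))).
    by apply: ler_wpM2l; [rewrite invr_ge0 ltW|exact: ltW].
  by rewrite le_eqVlt; apply/orP; left; apply/eqP; field; rewrite !gt_eqF.
rewrite LZ nrmZ nrmV nk; apply: (@le_trans _ _ ((r / 2 / nrm y)^-1 * n%:R)).
  by apply: ler_wpM2l => //; rewrite invr_ge0 ltW.
by rewrite le_eqVlt; apply/orP; left; apply/eqP; field; rewrite !gt_eqF.
Qed.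

(** Correcting the error again and again writes [x] as a series whose image under [L] converges
    geometrically. Closedness of the graph enters at the end, to identify the sum of the images with
    [L x]. *)
Theorem closed_graph : exists K : R, forall x, nrm (L x) <= K * nrm x.
Proof.
have [K K0 hK] := closed_graph_approx.
have ex (y : V) : exists a, nrm (y - a) <= 2^-1 * nrm y /\ nrm (L a) <= K * nrm y.
  by have [a] := hK y; exists a.
have [F hF] := choice ex.
exists (2 * K) => x; pose y n := iter n (fun y => y - F y) x.
have yn n : nrm (y n) <= nrm x * (2^-1) ^+ n.
  elim: n => [|n IH]; first by rewrite expr0 mulr1.
  by rewrite /= exprSr; have [] := hF (y n); rewrite -/(y n); lra.
pose u n := x - y n.
have ux : cvto u x.
  move=> e e0; have [N hN] := half_expr_small (nrm x) e0.
  exists N => n /hN h; rewrite /u addrC addKr nrmN; exact: le_trans (yn n) h.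
have uS n : u n.+1 - u n = F (y n).
  by rewrite /u /= !opprB addrC addrA subrK addrC subrK.
have [|m hm hm'] := @geometric_cvto R W (fun n => L (u n)) (K * nrm x).
  move=> n; rewrite -LB uS; have [_] := hF (y n) => /le_trans; apply.
  by rewrite -mulrA ler_wpM2l.
have := hm' 0%N; rewrite expr0 mulr1 /u /= subrr L0 sub0r nrmN (Lclosed ux hm); lra.
Qed.

End ClosedGraph.

Section BoxPole.
Variable R : realType.
Local Notation C := (Cplx R).

Lemma box_pole n (l : C) (r : R) : 0 < r ->
  4 <= cim (loop n (pole l) (cre l - r) (cim l - r) (2 * r)).
Proof.
move=> r0; have := grid_pole n 0 l r0 => /=.
by rewrite !big_ord1 /grd !mul0r !addr0 divr1.
Qed.

End BoxPole.

(** * Characters and maximal ideals *)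

Section CommBanachAlgebra.
Variables (R : realType) (A : completeNormedModType (Cplx R)).
Local Notation C := (Cplx R).
Variables (mul : A -> A -> A) (one : A).
Hypothesis algA : is_unital_comm_banach_algebra mul one.

Lemma bmulA x y z : mul x (mul y z) = mul (mul x y) z. Proof. exact: algA.1. Qed.
Lemma bmulC x y : mul x y = mul y x. Proof. exact: algA.2.1. Qed.
Lemma bmul1 x : mul one x = x. Proof. exact: algA.2.2.1. Qed.
Lemma bmull (a : C) x y z : mul (a *: x + y) z = a *: mul x z + mul y z.
Proof. exact: algA.2.2.2.1. Qed.
Lemma bmul_nrm x y : nrm (mul x y) <= nrm x * nrm y.
Proof. by have /cre_le := algA.2.2.2.2.1 x y; rewrite !nrmE -rcM. Qed.
Lemma bone_neq0 : one != 0. Proof. exact: algA.2.2.2.2.2. Qed.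

Lemma bmulDl x y z : mul (x + y) z = mul x z + mul y z.
Proof. by have := bmull 1 x y z; rewrite !scale1r. Qed.
Lemma bmul0l z : mul 0 z = 0.
Proof. by apply: (addrI (mul 0 z)); rewrite -bmulDl !addr0. Qed.
Lemma bmulZl a x z : mul (a *: x) z = a *: mul x z.
Proof. by have := bmull a x 0 z; rewrite bmul0l !addr0. Qed.
Lemma bmulBl x y z : mul (x - y) z = mul x z - mul y z.
Proof. by rewrite bmulDl -scaleN1r bmulZl scaleN1r. Qed.
Lemma bmulDr x y z : mul z (x + y) = mul z x + mul z y.
Proof. by rewrite !(bmulC z) bmulDl. Qed.
Lemma bmulBr x y z : mul z (x - y) = mul z x - mul z y.
Proof. by rewrite !(bmulC z) bmulBl. Qed.
Lemma bmulZr a x z : mul z (a *: x) = a *: mul z x.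
Proof. by rewrite !(bmulC z) bmulZl. Qed.
Lemma bmulr1 x : mul x one = x. Proof. by rewrite bmulC bmul1. Qed.

Lemma near_one_invertible x : nrm x <= 2^-1 -> exists y, mul (one - x) y = one.
Proof.
move=> x2; have [||y hy] := @neumann R A (mul x) _ _ one.
- by move=> a b; rewrite bmulBr.
- by move=> a; apply: (le_trans (bmul_nrm _ _)); rewrite ler_wpM2r ?nrm_ge0.
- by exists y; rewrite bmulBl bmul1.
Qed.

Lemma character_sub m x y : is_character mul one m -> m (x - y) = m x - m y.
Proof.
by move=> [ml _ _]; rewrite addrC -scaleN1r ml mulN1r addrC.
Qed.

Lemma character_scale m a x : is_character mul one m -> m (a *: x) = a * m x.
Proof.
move=> cm; have m0 : m 0 = 0 by rewrite -(subrr 0) character_sub // subrr.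
by have [ml _ _] := cm; have := ml a x 0; rewrite m0 !addr0.
Qed.

(** If [m x] were larger, one - x / m(x) would be invertible, although [m] kills it. The factor 2
    comes from the radius 1/2 in [near_one_invertible]. *)
Lemma character_bound m x : is_character mul one m -> nrm (m x) <= 2 * nrm x.
Proof.
move=> cm; rewrite leNgt; apply/negP => h; have [ml mm m1] := cm.
have mx0 : 0 < nrm (m x) by have := nrm_ge0 x; lra.
have mxn : m x != 0 by apply/eqP => e; rewrite e nrm0 ltxx in mx0.
have [|y hy] := @near_one_invertible ((m x)^-1 *: x).
  by rewrite nrmZ nrmV mulrC ler_pdivrMr //; lra.
have := congr1 m hy; rewrite mm character_sub // character_scale // mulVf // m1 subrr mul0r.
by move=> /esym/eqP; rewrite oner_eq0.
Qed.

Section MaximalIdeal.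
Variable I : set A.
Hypothesis maxI : is_maximal_ideal mul one I.

Let I0 : I 0. Proof. by have [[[]]] := maxI. Qed.
Let IB x y : I x -> I y -> I (x - y). Proof. by have [[[? h ?] _] _] := maxI; exact: h. Qed.
Let IM a x : I x -> I (mul a x). Proof. by have [[[? ? h] _] _] := maxI; exact: h. Qed.
Let I1 : ~ I one. Proof. by have [[_ h] _] := maxI. Qed.
Let IN x : I x -> I (- x). Proof. by move=> h; rewrite -sub0r; exact: IB. Qed.
Let ID x y : I x -> I y -> I (x + y). Proof. by move=> hx /IN h; rewrite -[y]opprK; exact: IB. Qed.
Let IZ (a : C) x : I x -> I (a *: x).
Proof. by move=> h; rewrite -[x]bmul1 -bmulZl; exact: IM. Qed.

Lemma maximal_ideal_inverse x : ~ I x -> exists y, I (mul y x - one).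
Proof.
move=> nx; pose J := [set z | exists y, I (z - mul y x)].
have [J1|nJ1] := pselect (J one).
  by have [y hy] := J1; exists y; rewrite -opprB; exact: IN.
exfalso; apply: nx; have <- : J = I; last by exists one; rewrite bmul1 subrr.
apply: maxI.2 => [|z Iz]; last by exists 0; rewrite bmul0l subr0.
split => //; split.
- by exists 0; rewrite bmul0l subrr.
- move=> a b [y hy] [y' hy']; exists (y - y'); rewrite bmulBl.
  have -> : a - b - (mul y x - mul y' x) = (a - mul y x) - (b - mul y' x).
    by rewrite !opprB [LHS](AC (2*2) ((1*4)*(3*2))).
  exact: IB.
- by move=> a b [y hy]; exists (mul a y); rewrite -bmulA -bmulBr; exact: IM.
Qed.

(** The quotient of [A] by [I] is never formed: this seminorm on [A], invariant under congruence
    modulo [I], stands for its norm. *)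
Definition quot_nrm (y : A) : R := inf [set nrm (y - i) | i in I].

Let qS_lb y : has_inf [set nrm (y - i) | i in I].
Proof.
split; first by exists (nrm (y - 0)); exists 0.
by exists 0 => _ [i _ <-]; exact: nrm_ge0.
Qed.

Lemma quot_nrm_le y i : I i -> quot_nrm y <= nrm (y - i).
Proof. by move=> Ii; apply: inf_lbound; [exact: (qS_lb y).2 | exists i]. Qed.

Lemma quot_nrm_ge y M : (forall i, I i -> M <= nrm (y - i)) -> M <= quot_nrm y.
Proof. by move=> h; apply: lb_le_inf; [exact: (qS_lb y).1 | move=> _ [i Ii <-]; exact: h]. Qed.

Lemma quot_nrm_ge0 y : 0 <= quot_nrm y.
Proof. by apply: quot_nrm_ge => i _; exact: nrm_ge0. Qed.

Lemma quot_nrmM a y : quot_nrm (mul a y) <= nrm a * quot_nrm y.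
Proof.
have [a0|a0] := eqVneq (nrm a) 0.
  rewrite (nrm_eq0 a0) bmul0l nrm0 mul0r; have := quot_nrm_le 0 I0.
  by rewrite subrr nrm0.
have na : 0 < nrm a by rewrite lt_def a0 nrm_ge0.
rewrite -ler_pdivrMl //; apply: quot_nrm_ge => i Ii; rewrite ler_pdivrMl //.
apply: le_trans (bmul_nrm _ _); rewrite bmulBr; apply: quot_nrm_le; exact: IM.
Qed.

Lemma quot_nrm_seminorm : seminorm quot_nrm.
Proof.
split=> [x y|a x]; last first.
  rewrite -[x]bmul1 -bmulZl; have [a0|a0] := eqVneq a 0.
    rewrite a0 scale0r bmul0l nrm0 mul0r; have := quot_nrm_le 0 I0.
    by rewrite subrr nrm0.
  have na := nrm_pos a0; rewrite -ler_pdivrMl //; apply: quot_nrm_ge => i Ii.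
  rewrite ler_pdivrMl // -nrmZ bmulZl scalerBr bmul1; apply: quot_nrm_le; exact: IZ.
rewrite -lerBlDl; apply: quot_nrm_ge => i Ii; rewrite lerBlDr -lerBlDl.
apply: quot_nrm_ge => j Ij; rewrite lerBlDr.
apply: le_trans (quot_nrm_le _ (ID Ij Ii)) _.
by rewrite opprD addrACA; exact: nrmD.
Qed.

Lemma quot_nrm_cong x y : I (x - y) -> quot_nrm x = quot_nrm y.
Proof.
have h a b : I (a - b) -> quot_nrm a <= quot_nrm b.
  move=> ab; apply: quot_nrm_ge => i Ii.
  have -> : b - i = a - (a - b + i) by rewrite opprD opprB addrA addrCA subrr addr0.
  by apply: quot_nrm_le; exact: ID.
by move=> xy; apply/le_anti; rewrite !h // -opprB; exact: IN.
Qed.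

(** An element of [I] within 1/2 of [one] would be invertible, and [I] would contain [one]. *)
Lemma quot_nrm_one : 0 < quot_nrm one.
Proof.
apply: (@lt_le_trans _ _ 2^-1); first by rewrite invr_gt0.
apply: quot_nrm_ge => i Ii; rewrite leNgt; apply/negP => /ltW /near_one_invertible[y].
by rewrite opprB addrCA subrr addr0 => e; apply: I1; rewrite -e bmulC; exact: IM.
Qed.

(** * The Gelfand-Mazur theorem *)

Section NoEigenvalue.
Variables (x : A) (y : C -> A).
Hypothesis hy : forall l, I (mul (y l) (x - l *: one) - one).

Lemma quot_resolvent l k : I (y l - y k - (l - k) *: mul (y l) (y k)).
Proof.
have -> : y l - y k - (l - k) *: mul (y l) (y k) =
    mul (y k) (mul (y l) (x - l *: one) - one) - mul (y l) (mul (y k) (x - k *: one) - one).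
  rewrite !bmulBr !bmulr1 !bmulZr !bmulr1 !bmulA (bmulC (y k) (y l)).
  set m := mul (y l) (y k); rewrite scalerBl !opprB.
  have -> : mul m x - l *: m - y k + (y l + (k *: m - mul m x)) =
      (y l - y k + (k *: m - l *: m)) + (mul m x - mul m x).
    by rewrite [LHS](AC (3*(1*2)) ((4*3*(5*2))*(1*6))).
  by rewrite subrr addr0.
by apply: IB; apply: IM; exact: hy.
Qed.

Lemma quot_resolvent_bound c z : nrm (z - c) * nrm (y c) <= 2^-1 ->
  quot_nrm (y z) <= 2 * quot_nrm (y c).
Proof.
move=> h; have [pD pZ] := quot_nrm_seminorm.
have e : quot_nrm (y z) = quot_nrm (y c + (z - c) *: mul (y c) (y z)).
  by apply: quot_nrm_cong; rewrite opprD addrA bmulC; exact: quot_resolvent.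
have h1 := pD (y c) ((z - c) *: mul (y c) (y z)); rewrite -e in h1.
have h2 := pZ (z - c) (mul (y c) (y z)).
have h3 := ler_wpM2l (nrm_ge0 (z - c)) (quot_nrmM (y c) (y z)).
have h4 := ler_wpM2r (quot_nrm_ge0 (y z)) h.
rewrite mulrA in h3; lra.
Qed.

(** The derivative is y(c)^2. Using the resolvent identity twice leaves the remainder (z - c)^2
    y(c)^2 y(z) modulo [I], and y(z) stays bounded near [c]. *)
Lemma quot_resolvent_diff c : pdiff quot_nrm y c.
Proof.
exists (mul (y c) (y c)) => e e0; have [pD pZ] := quot_nrm_seminorm.
set w := mul (y c) (y c).
pose K := nrm w * (2 * quot_nrm (y c)).
have K0 : 0 <= K by rewrite !mulr_ge0 ?nrm_ge0 ?quot_nrm_ge0.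
have yc := nrm_ge0 (y c).
exists (Num.min (2^-1 / (nrm (y c) + 1)) (e / (K + 1))).
  by rewrite lt_min !divr_gt0 //; lra.
move=> z; rewrite lt_min => /andP[z1 z2].
have b : quot_nrm (y z) <= 2 * quot_nrm (y c).
  apply: quot_resolvent_bound; apply: (@le_trans _ _ (nrm (z - c) * (nrm (y c) + 1))).
    by rewrite ler_wpM2l ?nrm_ge0 //; lra.
  by rewrite -ler_pdivlMr ?ltW //; lra.
have -> : quot_nrm (y z - (y c + (z - c) *: w)) = quot_nrm ((z - c) *: ((z - c) *: mul w (y z))).
  apply: quot_nrm_cong.
  have -> : y z - (y c + (z - c) *: w) - (z - c) *: ((z - c) *: mul w (y z)) =
     (y z - y c - (z - c) *: mul (y z) (y c)) +
     (z - c) *: mul (y c) (y z - y c - (z - c) *: mul (y z) (y c)).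
    rewrite !bmulBr bmulZr -/w (bmulC (y z) (y c)) bmulA -/w !scalerBr opprD.
    by rewrite [RHS](AC (3*3) (1*2*5*6*(4*3))) /= subrr addr0 !addrA.
  by apply: ID; [|apply: IZ; apply: IM]; exact: quot_resolvent.
have n0 := nrm_ge0 (z - c).
apply: (le_trans (pZ _ _)); rewrite mulrC ler_wpM2r //.
apply: (le_trans (pZ _ _)); apply: (@le_trans _ _ (nrm (z - c) * (K + 1))).
  rewrite ler_wpM2l //; apply: (le_trans (quot_nrmM _ _)).
  by have := ler_wpM2l (nrm_ge0 w) b; rewrite -/K; lra.
by rewrite -ler_pdivlMr ?ltW //; lra.
Qed.

(** At infinity y(l) is -1 / l up to O(|l|^-2), so its integral over a large square compares with
    that of the pole at 0. *)
Lemma quot_resolvent_far (l : C) : 2 * nrm x < nrm l ->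
  quot_nrm (y l + (l^-1 : C) *: one) <= 2 * nrm x * quot_nrm one / nrm l ^+ 2.
Proof.
move=> hl; have [pD pZ] := quot_nrm_seminorm; have x0 := nrm_ge0 x.
have l0 : 0 < nrm l by lra.
have ln : l != 0 by apply/eqP => e; rewrite e nrm0 ltxx in l0.
have e : quot_nrm (y l + l^-1 *: one) = quot_nrm (l^-1 *: mul x (y l)).
  apply: quot_nrm_cong.
  have -> : y l + l^-1 *: one - l^-1 *: mul x (y l) = (- l^-1) *: (mul (y l) (x - l *: one) - one).
    rewrite bmulBr bmulZr bmulr1 !scalerBr !scalerA mulNr mulVf // !scaleNr scale1r !opprK.
    by rewrite (bmulC x) [LHS](AC 3 ((3*1)*2)).
  by apply: IZ; exact: hy.
have h1 := pZ l^-1 (mul x (y l)); rewrite -e nrmV in h1.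
have h2 := quot_nrmM x (y l).
have h3 : quot_nrm (y l) <= (nrm l)^-1 * quot_nrm one + (nrm l)^-1 * (nrm x * quot_nrm (y l)).
  have -> : y l = (y l + l^-1 *: one) + (- l^-1) *: one by rewrite scaleNr addrK.
  apply: le_trans (pD _ _) _; rewrite addrC lerD //.
    by apply: le_trans (pZ _ _) _; rewrite nrmN nrmV.
  rewrite scaleNr addrK; apply: le_trans h1 _; rewrite ler_wpM2l // invr_ge0 ltW //.
have l1 : 0 < (nrm l)^-1 by rewrite invr_gt0.
have h4 : nrm x * (nrm l)^-1 <= 2^-1 by rewrite ler_pdivrMr //; lra.
have h5 := ler_wpM2r (quot_nrm_ge0 (y l)) h4.
have h6 : quot_nrm (y l) <= 2 * (nrm l)^-1 * quot_nrm one by lra.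
apply: le_trans h1 _; apply: le_trans (ler_wpM2l (ltW l1) h2) _.
have := ler_wpM2l (mulr_ge0 (ltW l1) x0) h6.
have -> : 2 * nrm x * quot_nrm one / nrm l ^+ 2 = (nrm l)^-1 * nrm x * (2 * (nrm l)^-1 * quot_nrm one).
  by field; rewrite gt_eqF.
by apply: le_trans; rewrite mulrA.
Qed.

(** The function [y] is entire for the quotient seminorm, so its sums around a square become small.
    Adding one / z leaves a small sum too, by decay at infinity; but the sum of one / z is
    [P *: one] with [nrm P] at least 4. *)
Lemma quot_resolvent_absurd : False.
Proof.
have ps := quot_nrm_seminorm; have [pD pZ] := ps; have x0 := nrm_ge0 x.
(* This makes [r] exceed [2 * nrm x] and the error 16 |x| / r at most 1. *)
pose r := 16 * (nrm x + 1); have r0 : 0 < r by rewrite /r; lra.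
have q1 := quot_nrm_one.
have [|N /(_ N (leqnn _)) hN] := @goursat R A quot_nrm y (0 - r) (0 - r) (2 * r) ps _
   (fun c _ => quot_resolvent_diff c) _ q1; first by lra.
have hb := box_pole N (0 : C) r0; rewrite cre0 cim0 in hb.
set P := loop N (pole 0) _ _ _ in hb.
have P4 : 4 <= nrm P by have := cim_le_nrm P; have := ler_norm (cim P); lra.
have hs : quot_nrm (loop N (fun z => y z + pole 0 z *: one) (0 - r) (0 - r) (2 * r)) <=
    4 * (2 * r) * (2 * nrm x * quot_nrm one / r ^+ 2).
  apply: loop_bound => //; first by lra.
  move=> z _ hz; have nz : r <= nrm z.
    have a1 := cre_le_nrm z; have a2 := cim_le_nrm z.
    have a3 := ler_norm (cre z); have a4 := ler_norm (cim z).
    have a5 := ler_norm (- cre z); have a6 := ler_norm (- cim z).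
    rewrite !normrN in a5 a6; case: hz => [h|[h|[h|h]]]; lra.
  rewrite /pole subr0; apply: le_trans (quot_resolvent_far _) _; first by rewrite /r in nz; lra.
  rewrite ler_wpM2l ?mulr_ge0 ?quot_nrm_ge0 // lef_pV2 ?posrE ?exprn_gt0 //; last by lra.
  by rewrite ler_pXn2r ?nnegrE //; lra.
rewrite loopD loop_scal -/P in hs.
have e1 : quot_nrm (P *: one) <= 2 * quot_nrm one.
  set Y := loop N y _ _ _ in hN hs.
  have -> : P *: one = (Y + P *: one) + - Y by rewrite addrC addKr.
  apply: le_trans (pD _ _) _; have := seminormN Y ps.
  have : 4 * (2 * r) * (2 * nrm x * quot_nrm one / r ^+ 2) <= quot_nrm one.
    have -> : 4 * (2 * r) * (2 * nrm x * quot_nrm one / r ^+ 2) = (16 * nrm x / r) * quot_nrm one.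
      by field; lra.
    by rewrite ger_pMl // ler_pdivrMr //; rewrite /r; lra.
  lra.
have Pn : P != 0 by apply/eqP => e; rewrite e nrm0 in P4; lra.
have := pZ P^-1 (P *: one); rewrite scalerA mulVf // scale1r nrmV.
rewrite ler_pdivlMl; last by lra.
have := ler_wpM2r (ltW q1) P4; lra.
Qed.

End NoEigenvalue.

Theorem gelfand_mazur x : exists l : C, I (x - l *: one).
Proof.
apply: contrapT => no.
have ex (l : C) : exists y, I (mul y (x - l *: one) - one).
  by apply: maximal_ideal_inverse => h; apply: no; exists l.
have [y hy] := choice ex; exact: (quot_resolvent_absurd hy).
Qed.

(** The scalar given by [gelfand_mazur] is unique because [I] is proper, and uniqueness makes its
    choice linear and multiplicative. *)
Lemma maximal_ideal_character : exists2 m, is_character mul one m & forall x, m x = 0 -> I x.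
Proof.
have [m hm] := choice gelfand_mazur.
have uniq x l : I (x - l *: one) -> m x = l.
  move=> hl; apply/eqP; rewrite -subr_eq0; apply/negP => /negP ml; apply: I1.
  have := IZ (m x - l)^-1 (IB hl (hm x)).
  have -> : x - l *: one - (x - m x *: one) = (m x - l) *: one.
    by rewrite opprB [LHS](AC (2*2) ((1*4)*(3*2))) /= subrr add0r scalerBl.
  by rewrite scalerA mulVf // scale1r.
exists m; last by move=> x e; have := hm x; rewrite e scale0r subr0.
split.
- move=> a x y; apply: uniq.
  have -> : a *: x + y - (a * m x + m y) *: one = a *: (x - m x *: one) + (y - m y *: one).
    by rewrite scalerDl opprD addrACA scalerBr scalerA.
  by apply: ID => //; exact: IZ.
- move=> x y; apply: uniq.
  have -> : mul x y - (m x * m y) *: one =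
     mul y (x - m x *: one) + m x *: (y - m y *: one).
    by rewrite bmulBr bmulZr bmulr1 scalerBr scalerA bmulC addrA subrK.
  by apply: ID; [exact: IM|exact: IZ].
- by apply: uniq; rewrite scale1r subrr.
Qed.

End MaximalIdeal.

Hypothesis ssA : semisimple mul one.

Lemma characters_separate x : (forall m, is_character mul one m -> m x = 0) -> x = 0.
Proof.
move=> h; have : radical mul one x.
  by move=> I /maximal_ideal_character[m cm hI]; apply: hI; exact: h.
by rewrite ssA.
Qed.

(** Separation does it: without any character, [one] would satisfy the hypothesis of
    [characters_separate] vacuously. *)
Lemma character_exists : exists m, is_character mul one m.
Proof.
apply: contrapT => no; have /negP := bone_neq0; apply; apply/eqP.
by apply: characters_separate => m cm; case: no; exists m.
Qed.

End CommBanachAlgebra.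

(** * The Shilov boundary *)

Section CharacterSpace.
Variables (R : realType) (A : completeNormedModType (Cplx R)).
Local Notation C := (Cplx R).
Variables (mul : A -> A -> A) (one : A).
Hypothesis algA : is_unital_comm_banach_algebra mul one.
Local Notation char := (is_character mul one).
Local Notation gclosed := (@gelfand_closed R A mul one).
Local Notation boundary := (@is_boundary R A mul one).

(** Cluster points for the Gelfand topology, through its basic neighbourhoods; these are cut down to
    characters, as in [gelfand_closed]. *)
Definition clusters (F : set_system (A -> C)) (m : A -> C) :=
  forall B, F B -> forall (fs : seq A) (e : R), 0 < e ->
    exists m', [/\ B m', char m' & forall f, f \in fs -> nrm (m' f - m f) < e].

Lemma approx_eq0 (z : C) (K : R) : (forall e : R, 0 < e -> nrm z <= K * e) -> z = 0.
Proof.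
move=> h; apply: nrm_le0; apply/ler_addgt0Pr => e e0; rewrite add0r.
have K0 : 0 < `|K| + 1 by have := normr_ge0 K; lra.
apply: le_trans (h _ (divr_gt0 e0 K0)) _.
rewrite mulrCA ger_pMr // ler_pdivrMr // mul1r; have := ler_norm K; lra.
Qed.

(** Each law of a character relates at most three values of [m], and a character close to [m] at
    these elements satisfies it. *)
Lemma clusters_character F m : F setT -> clusters F m -> char m.
Proof.
move=> FT Fm; split.
- move=> a x y; apply/eqP; rewrite -subr_eq0; apply/eqP/(@approx_eq0 _ (nrm a + 2)) => e e0.
  have [m' [_ cm h]] := Fm _ FT [:: x; y; a *: x + y] _ e0; have [ml _ _] := cm.
  have h1 := h x ltac:(by rewrite !inE eqxx).
  have h2 := h y ltac:(by rewrite !inE eqxx ?orbT).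
  have h3 := h (a *: x + y) ltac:(by rewrite !inE eqxx ?orbT).
  have -> : m (a *: x + y) - (a * m x + m y) =
     (a * (m' x - m x) + (m' y - m y)) - (m' (a *: x + y) - m (a *: x + y)).
    by rewrite ml; ring.
  apply: le_trans (nrmBD _ _) _; have := nrmD (a * (m' x - m x)) (m' y - m y).
  rewrite nrmM; have := ler_wpM2l (nrm_ge0 a) (ltW h1); lra.
- move=> x y; apply/eqP; rewrite -subr_eq0; apply/eqP/(@approx_eq0 _ (2 * nrm x + nrm (m y) + 1)) => e e0.
  have [m' [_ cm h]] := Fm _ FT [:: x; y; mul x y] _ e0; have [_ mm _] := cm.
  have h1 := h x ltac:(by rewrite !inE eqxx).
  have h2 := h y ltac:(by rewrite !inE eqxx ?orbT).
  have h3 := h (mul x y) ltac:(by rewrite !inE eqxx ?orbT).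
  have -> : m (mul x y) - m x * m y =
     (m' x * (m' y - m y) + (m' x - m x) * m y) - (m' (mul x y) - m (mul x y)).
    by rewrite mm; ring.
  apply: le_trans (nrmBD _ _) _.
  have := nrmD (m' x * (m' y - m y)) ((m' x - m x) * m y); rewrite !nrmM.
  have := ler_wpM2r (nrm_ge0 (m y)) (ltW h1).
  have := ler_wpM2l (nrm_ge0 (m' x)) (ltW h2).
  have := ler_wpM2r (ltW e0) (character_bound algA x cm); lra.
- apply/eqP; rewrite -subr_eq0; apply/eqP/(@approx_eq0 _ 1) => e e0.
  have [m' [_ [_ _ m1] h]] := Fm _ FT [:: one] _ e0.
  by have := h one (mem_head _ _); rewrite m1 nrmB; lra.
Qed.

(** Banach-Alaoglu: by [character_bound] the characters lie in a product of real segments, compact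
    by Tychonoff. *)
Lemma character_space_compact (F : set_system (A -> C)) : ProperFilter F -> F char ->
  exists2 m, char m & clusters F m.
Proof.
move=> PF Fc; pose I : eqType := (A * bool)%type.
pose T (i : I) : topologicalType := R.
pose K (i : I) : set (T i) := `[- (2 * nrm i.1), 2 * nrm i.1]%classic.
(* The boolean index selects the real or the imaginary part of the value, so that all factors are
   real segments. *)
pose Phi (m : A -> C) : forall i : I, T i := fun i => if i.2 then cre (m i.1) else cim (m i.1).
have cK : forall i, compact (K i) by move=> i; exact: segment_compact.
have PG : ProperFilter (Phi @ F) by exact: fmap_proper_filter.
have GK : (Phi @ F) [set f | forall i, K i (f i)].
  suff : F [set m | forall i, K i (Phi m i)] by [].
  apply: filterS Fc => m cm i /=; rewrite /K /= in_itv /= -ler_norml.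
  apply: le_trans (character_bound algA i.1 cm).
  suff h b : `|if b then cre (m i.1) else cim (m i.1)| <= nrm (m i.1) by exact: h.
  by case: b; [exact: cre_le_nrm|exact: cim_le_nrm].
have [phi [_ cphi]] := tychonoff cK PG GK.
pose m f := cpx (phi (f, true)) (phi (f, false)).
have Fm : clusters F m.
  move=> B FB fs e e0.
  have nb : nbhs phi [set psi | forall f, f \in fs -> forall b, `|(psi (f, b) : R) - phi (f, b)| < e / 2].
    elim: fs => [|f fs IH].
      by apply: (filterS _ filterT) => psi _ f; rewrite in_nil.
    have one_nb b : nbhs phi [set psi : forall i, T i | `|(psi (f, b) : R) - phi (f, b)| < e / 2].
      have /= := @proj_continuous I T (f, b) phi [set t : R | `|t - phi (f, b)| < e / 2].
      apply; apply/nbhs_ballP; exists (e / 2) => /=; first by lra.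
      by move=> t; rewrite /ball /= distrC.
    apply: filterS (filterI (filterI (one_nb true) (one_nb false)) IH).
    move=> psi [[h1 h2] h3] f'; rewrite in_cons => /orP[/eqP -> [] //|/h3]; exact.
  have [psi [[m' [Bm cm] <-] hpsi]] : [set Phi m' | m' in B `&` char] `&`
     [set psi | forall f, f \in fs -> forall b, `|(psi (f, b) : R) - phi (f, b)| < e / 2] !=set0.
    apply: cphi => //.
    suff : F [set m' | exists2 m, (B `&` char) m & Phi m = Phi m'] by [].
    by apply: filterS (filterI FB Fc) => m' hm; exists m'.
  exists m'; split => // f ffs; apply: le_lt_trans (nrm_le_reim _) _.
  have h1 := hpsi f ffs true; have h2 := hpsi f ffs false.
  by rewrite /m !cE; move: h1 h2; rewrite /Phi /=; lra.
by exists m => //; apply: clusters_character Fm; exact: filterT.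
Qed.

Lemma gclosed_clusters S F m : gclosed S -> F S -> char m -> clusters F m -> S m.
Proof.
move=> [_ cS] FS cm Fm; apply: contrapT => nS; have [fs [e [e0 he]]] := cS _ cm nS.
have [m' [Sm' cm' h]] := Fm _ FS fs e e0.
by apply: (he m') => // f /h; rewrite nrm_lt.
Qed.

Lemma gclosed_chars : gclosed char.
Proof. by split => // m cm. Qed.

Lemma gclosedI S S' : gclosed S -> gclosed S' -> gclosed (S `&` S').
Proof.
move=> [sS cS] [_ cS']; split => [m [/sS]//|m cm nm].
have [Sm|nSm] := pselect (S m).
  have [|fs [e [e0 he]]] := cS' m cm; first by move=> S'm; apply: nm.
  by exists fs, e; split => // m' cm' h [_]; exact: he.
have [fs [e [e0 he]]] := cS m cm nSm.
by exists fs, e; split => // m' cm' h [+ _]; exact: he.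
Qed.

Lemma max_attained S g : gclosed S -> S !=set0 ->
  exists2 m, S m & forall m', S m' -> nrm (m' g) <= nrm (m g).
Proof.
move=> cS [m0 Sm0]; have [sS _] := cS.
pose X := [set nrm (m g) | m in S].
have hX : has_sup X.
  split; first by exists (nrm (m0 g)); exists m0.
  by exists (2 * nrm g) => _ [m /sS cm <-]; exact: (character_bound algA).
(* A filter along which [nrm (m g)] tends to its supremum; a cluster point attains it. *)
pose F : set_system (A -> C) := [set B | exists2 e : R, 0 < e & S `&` [set m | sup X - e < nrm (m g)] `<=` B].
have FF : ProperFilter F.
  split.
    move=> [e e0 he]; have [_ [m Sm <-] hm] := sup_adherent e0 hX.
    by apply: (he m); split.
  split.
  - by exists 1.
  - move=> P Q [e e0 he] [d d0 hd]; exists (Num.min e d); first by rewrite lt_min e0.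
    move=> m [Sm hm]; have h1 : Num.min e d <= e by rewrite ge_min lexx.
    have h2 : Num.min e d <= d by rewrite ge_min lexx orbT.
    by rewrite /= in hm; split; [apply: he|apply: hd]; split => //=; lra.
  - by move=> P Q PQ [e e0 he]; exists e => // m /he /PQ.
have FS : F S by exists 1 => // m [].
have [m cm Fm] : exists2 m, char m & clusters F m.
  by apply: character_space_compact; apply: filterS FS; exact: sS.
exists m; first exact: gclosed_clusters Fm.
move=> m' Sm'; have up : nrm (m' g) <= sup X by apply: sup_upper_bound => //; exists m'.
apply: le_trans up _; apply/ler_addgt0Pr => e e0.
have e2 : 0 < e / 2 by lra.
have [|m1 [[_ /= h1] _ h2]] := Fm (S `&` [set m | sup X - e / 2 < nrm (m g)]) _ [:: g] _ e2.
  by exists (e / 2).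
have := h2 g (mem_head _ _); have := nrmD (m1 g - m g) (m g); rewrite subrK; lra.
Qed.

Definition gball (m0 : A -> C) (fs : seq A) (e : R) : set (A -> C) :=
  [set m | forall f, f \in fs -> nrm (m f - m0 f) < e].

Lemma gclosed_setC_gball m0 fs e : gclosed (char `&` ~` gball m0 fs e).
Proof.
split => [m []//|m cm nm].
have {}nm : gball m0 fs e m by apply: contrapT => h; apply: nm.
elim: fs nm => [|f fs IH] nm.
  by exists [::], 1; split => // m' _ _ [_]; apply.
have [|fs' [e' [e'0 h]]] := IH; first by move=> f' hf; apply: nm; rewrite in_cons hf orbT.
have d0 : 0 < e - nrm (m f - m0 f) by rewrite subr_gt0; apply: nm; exact: mem_head.
exists (f :: fs'), (Num.min e' (e - nrm (m f - m0 f))); split; first by rewrite lt_min e'0.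
move=> m' cm' hm' [_]; apply => f'; rewrite in_cons => /orP[/eqP ->|hf'].
  have := hm' f (mem_head _ _); rewrite nrm_lt lt_min => /andP[_ h1].
  by have := nrm_trans (m f) (m' f) (m0 f); lra.
have := h m' cm'; have {}h : forall g, g \in fs' -> `|m' g - m g| < (e'%:C)%C.
  move=> g gfs; have := hm' g; rewrite in_cons gfs orbT => /(_ isT).
  by rewrite !nrm_lt lt_min => /andP[].
move=> /(_ h) nn; have : gball m0 fs e m' by apply: contrapT => k; apply: nn.
exact.
Qed.

Definition bpow (g : A) n := iter n (mul g) one.

Lemma char_bpow m g n : char m -> m (bpow g n) = m g ^+ n.
Proof. by move=> [_ mm m1]; elim: n => [|n IH]; rewrite ?expr0 //= mm IH exprS. Qed.

Lemma expr_small (q M B e : R) : 0 <= q -> q < M -> 0 < e -> exists N : nat, q ^+ N * B < M ^+ N * e.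
Proof.
move=> q0 qM e0; have M0 : 0 < M by lra.
have tn : `|q / M| = q / M by rewrite ger0_norm // divr_ge0 // ltW.
have t1 : `|q / M| < 1 by rewrite tn ltr_pdivrMr // mul1r.
have B1 : 0 < `|B| + 1 by have := normr_ge0 B; lra.
have /cvgrPdist_lt /(_ _ (divr_gt0 e0 B1)) [N _ /(_ N (leqnn _))] := cvg_expr t1.
rewrite sub0r normrN normrX tn ltr_pdivlMr // => h.
exists N; have MN : 0 < M ^+ N by rewrite exprn_gt0.
apply: le_lt_trans (_ : q ^+ N * (`|B| + 1) < _).
  by rewrite ler_wpM2l ?exprn_ge0 //; have := ler_norm B; lra.
by move: h; rewrite expr_div_n mulrAC ltr_pdivrMr // [e * _]mulrC.
Qed.

(** Strictness survives because the maximum is attained on [S]. *)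
Lemma boundary_le S f (K : R) m : boundary S -> (forall t, S t -> nrm (t f) < K) ->
  char m -> nrm (m f) < K.
Proof.
move=> [_ hS] hK cm; have [t St /(_ m cm)] := hS f; rewrite !nrmE rc_le => h.
exact: le_lt_trans h (hK _ St).
Qed.

(* If h has its maximum modulus M on E but not on E minus the ball, a high power h^N
   makes h^N (f - m0 f) smaller than M^N e on E, hence everywhere, for f in fs. So
   every point where |h| = M lies in the ball, and E' contains such a point. *)
Lemma boundary_remove m0 fs e E E' : char m0 -> 0 < e -> boundary E' ->
  (forall m, E' m -> ~ gball m0 fs e m) -> gclosed E -> boundary E ->
  boundary (E `&` (char `&` ~` gball m0 fs e)).
Proof.
move=> cm0 e0 bE' dE' cE bE; set V := gball m0 fs e in dE' *.
have [sE hE] := bE; split; first by move=> m [/sE].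
move=> g; apply: contrapT => no.
have cEV : gclosed (E `&` (char `&` ~` V)) by apply: gclosedI => //; exact: gclosed_setC_gball.
have [h [q [M [q0 qM hM hq]]]] : exists h q M, [/\ 0 <= q, q < M,
    (exists2 mM, char mM & M = nrm (mM h)) /\ (forall m, char m -> nrm (m h) <= M)
    & forall m, E m -> ~ V m -> nrm (m h) <= q].
  (* If [E] lies inside the ball, [one] serves as [h], with q = 0 and M = 1. Otherwise [h] is the
     element [g] on which the smaller set fails to be a boundary. *)
  have [ne|em] := pselect (E `&` (char `&` ~` V) !=set0); last first.
    exists one, 0, 1; split => //.
      split => [|m [_ _ ->]]; last by rewrite nrm1.
      by exists m0 => //; have [_ _ ->] := cm0; rewrite nrm1.
    by move=> m Em nV; case: em; exists m; split => //; split => //; exact: sE.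
  have [m1 [Em1 [cm1 Vm1]] hm1] := max_attained g cEV ne.
  have [mM EM hmM] := hE g.
  exists g, (nrm (m1 g)), (nrm (mM g)); split; first exact: nrm_ge0.
  - rewrite ltNge; apply/negP => le; apply: no; exists m1 => // m' cm'.
    by apply: le_trans (hmM _ cm') _; rewrite !nrmE rc_le.
  - split; first by exists mM => //; exact: sE.
    by move=> m cm; have := hmM _ cm; rewrite !nrmE rc_le.
  - by move=> m Em nV; apply: hm1; split => //; split => //; exact: sE.
have [[mM cmM MM] hM'] := hM.
pose k f := f - m0 f *: one.
have kE m f : char m -> m (k f) = m f - m0 f.
  move=> cm; rewrite /k (character_sub _ _ cm) (character_scale _ _ cm).
  by have [_ _ ->] := cm; rewrite mulr1.
have M0 : 0 < M by lra.
have key f : f \in fs -> exists N : nat, forall m, E m -> nrm (m (mul (bpow h N) (k f))) < M ^+ N * e.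
  move=> ffs; have [N hN] := expr_small (2 * nrm (k f)) q0 qM e0.
  exists N => m Em; have cm := sE _ Em; have [_ mm _] := cm.
  rewrite mm char_bpow // nrmM nrmX.
  have [Vm|nVm] := pselect (V m).
    rewrite kE //; apply: (@le_lt_trans _ _ (M ^+ N * nrm (m f - m0 f))).
      apply: ler_wpM2r; first exact: nrm_ge0.
      by apply: lerXn2r; rewrite ?nnegrE ?nrm_ge0 ?(ltW M0) //; exact: hM'.
    by rewrite ltr_pM2l ?exprn_gt0 //; exact: Vm.
  apply: le_lt_trans hN; apply: ler_pM; rewrite ?exprn_ge0 ?nrm_ge0 //.
    by apply: lerXn2r; rewrite ?nnegrE ?nrm_ge0 //; exact: hq.
  exact: (character_bound algA (k f) cm).
have [_ /(_ h)[m1 Em1 hm1]] := bE'; have cm1 : char m1 by exact: bE'.1.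
have m1M : M <= nrm (m1 h) by rewrite MM; have := hm1 _ cmM; rewrite !nrmE rc_le.
apply: (dE' m1 Em1) => f ffs; have [N hN] := key f ffs.
have := boundary_le bE hN cm1; have [_ mm _] := cm1.
rewrite mm char_bpow // nrmM nrmX kE //.
have -> : nrm (m1 h) = M by apply/le_anti; rewrite m1M hM'.
by rewrite ltr_pM2l ?exprn_gt0.
Qed.

Lemma character_space_boundary : (exists m, char m) -> boundary char.
Proof.
move=> ne; split => // f; have [m cm hm] := max_attained f gclosed_chars ne.
by exists m => // m' /hm; rewrite !nrmE rc_le.
Qed.

(* The closed sets meeting every closed boundary in a boundary are stable under
   intersection; a cluster point of the maximizers of f along them is in the Shilov
   boundary. *)
Theorem shilov_boundary_max f : (exists m, char m) ->
  exists2 t, shilov_boundary mul one t & forall m, char m -> nrm (m f) <= nrm (t f).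
Proof.
move=> ne; have bM := character_space_boundary ne.
pose good (E : set (A -> C)) := gclosed E /\
  forall D, gclosed D -> boundary D -> boundary (D `&` E).
have goodM : good char.
  by split; [exact: gclosed_chars|move=> D cD bD; have -> : D `&` char = D by apply: setIidl; exact: bD.1].
have goodI E E' : good E -> good E' -> good (E `&` E').
  move=> [cE hE] [cE' hE']; split; first exact: gclosedI.
  by move=> D cD bD; rewrite setIA; apply: hE'; [exact: gclosedI|exact: hE].
pose F : set_system (A -> C) := [set B | exists2 E, good E &
   E `&` [set m | forall m', char m' -> nrm (m' f) <= nrm (m f)] `<=` B].
have FF : ProperFilter F.
  split.
    move=> [E [cE gE] hE]; have bE : boundary E.
      have -> : E = char `&` E by apply/esym/setIidr; exact: cE.1.
      exact: gE gclosed_chars bM.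
    have [t Et ht] := bE.2 f; apply: (hE t); split => // m' /ht.
    by rewrite !nrmE rc_le.
  split.
  - by exists char.
  - move=> P Q [E gE hE] [E' gE' hE']; exists (E `&` E'); first exact: goodI.
    by move=> m [[Em Em'] hm]; split; [apply: hE|apply: hE'].
  - by move=> P Q PQ [E gE hE]; exists E => // m /hE /PQ.
have Fc : F char by exists char => // m [].
have [t ct Ft] := character_space_compact FF Fc.
have inE E : good E -> E t.
  by move=> gE; apply: gclosed_clusters Ft => //; [exact: gE.1|exists E => // m []].
exists t; last first.
  move=> m cm; apply/ler_addgt0Pr => e e0.
  have [|m1 [/(_ m cm) h1 _ h2]] := Ft [set m | forall m', char m' -> nrm (m' f) <= nrm (m f)] _ [:: f] _ e0.
    by exists char => // m' [].
  have := h2 f (mem_head _ _); have := nrmD (m1 f - t f) (t f); rewrite subrK; lra.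
move=> S cS bS; apply: contrapT => nS.
have [fs [e [e0 he]]] := cS.2 t ct nS.
have : good (char `&` ~` gball t fs e).
  split; first exact: gclosed_setC_gball.
  move=> D cD bD; apply: (@boundary_remove t fs e D S) => // m Sm hm.
  by apply: (he m) => //; [exact: bS.1|move=> g /hm; rewrite nrm_lt].
by move=> /inE[_]; apply => g _; rewrite subrr nrm0.
Qed.

Hypothesis ssA : semisimple mul one.

Lemma shilov_character t : shilov_boundary mul one t -> char t.
Proof.
apply; first exact: gclosed_chars.
exact: character_space_boundary (character_exists algA ssA).
Qed.

(** Injectivity of the embedding J. *)
Lemma shilov_separate x : (forall t, shilov_boundary mul one t -> t x = 0) -> x = 0.
Proof.
move=> h; apply: (characters_separate algA ssA) => m cm; apply: nrm_le0.
have [t /h tx /(_ m cm)] := shilov_boundary_max x (character_exists algA ssA).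
by rewrite tx nrm0.
Qed.

End CharacterSpace.

(** * Resolvents *)

Section Resolvent.
Variables (R : realType) (A : completeNormedModType (Cplx R)).
Local Notation C := (Cplx R).
Variable T : A -> A.
Hypothesis Tlin : forall (k : C) x y, T (k *: x + y) = k *: T x + T y.
Variable KT : R.
Hypothesis Tbnd : forall x, nrm (T x) <= KT * nrm x.

Let TD x y : T (x + y) = T x + T y. Proof. by have := Tlin 1 x y; rewrite !scale1r. Qed.
Let T0 : T 0 = 0. Proof. by apply: (addrI (T 0)); rewrite -TD !addr0. Qed.
Let TZ k x : T (k *: x) = k *: T x. Proof. by have := Tlin k x 0; rewrite T0 !addr0. Qed.
Let TB x y : T (x - y) = T x - T y. Proof. by rewrite TD -scaleN1r TZ scaleN1r. Qed.

Definition shift l x := T x - l *: x.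

Lemma shiftB l x y : shift l (x - y) = shift l x - shift l y.
Proof. by rewrite /shift TB scalerBr !opprB [LHS](AC (2*2) ((1*4)*(3*2))). Qed.

Lemma shiftZ l k x : shift l (k *: x) = k *: shift l x.
Proof. by rewrite /shift TZ scalerBr !scalerA mulrC. Qed.

Lemma shift_lin l (k : C) x y : shift l (k *: x + y) = k *: shift l x + shift l y.
Proof. by rewrite /shift Tlin scalerDr scalerBr !scalerA (mulrC l) opprD addrACA. Qed.

Lemma shift_change l k x : shift l x = shift k x - (l - k) *: x.
Proof. by rewrite /shift scalerBl opprB addrA subrK. Qed.

Lemma shift_cvto l u x : cvto u x -> cvto (fun n => shift l (u n)) (shift l x).
Proof.
apply: (cvto_lip (K := KT + nrm l)) => a b; rewrite -shiftB /shift.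
apply: le_trans (nrmBD _ _) _; rewrite nrmZ mulrDl lerD //.
Qed.

(** The spectrum is defined by bounded inverses; the closed graph theorem supplies the bound for an
    algebraic inverse, so that invertibility reduces to bijectivity. *)
Lemma spectrumN_bij l : ~ spectrumA T l <->
  (forall f, exists h, shift l h = f) /\ (forall h, shift l h = 0 -> h = 0).
Proof.
split.
  move=> /contrapT[S [_ S1 S2]]; split=> [f|h h0]; first by exists (S f); exact: S2.
  have s0 : shift l 0 = 0 by rewrite /shift T0 scaler0 subr0.
  by rewrite -(S1 h) -/(shift l h) h0 -s0 /shift S1.
move=> [sur inj]; have [S hS] := choice sur.
have inj2 x y : shift l x = shift l y -> x = y.
  by move=> e; apply/eqP; rewrite -subr_eq0; apply/eqP/inj; rewrite shiftB e subrr.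
have Slin (k : C) x y : S (k *: x + y) = k *: S x + S y.
  by apply: inj2; rewrite shift_lin !hS.
have [K hK] : exists K : R, forall x, nrm (S x) <= K * nrm x.
  apply: closed_graph Slin _ => u x m ux Sm; apply: inj2; rewrite hS.
  by apply: cvto_unique (shift_cvto l Sm) _; apply: cvto_ext ux => n; rewrite hS.
move=> nS; apply: nS; exists S; split.
- by exists (rc K) => f; rewrite !nrmE -rcM rc_le.
- by move=> f; apply: inj2; rewrite hS.
- exact: hS.
Qed.

Lemma resolvent_exists l : ~ spectrumA T l -> exists S : A -> A, exists2 K : R, 0 < K &
  [/\ forall f, shift l (S f) = f, forall f, S (shift l f) = f
    & forall f, nrm (S f) <= K * nrm f].
Proof.
move=> /contrapT[S [[K hK] S1 S2]]; exists S, (`|cre K| + 1).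
  by have := normr_ge0 (cre K); lra.
split => // f; have := hK f => /cre_le; rewrite !nrmE cE creM cE cim_rc mulr0 subr0 => h.
by apply: le_trans h _; rewrite ler_wpM2r ?nrm_ge0 //; have := ler_norm (cre K); lra.
Qed.

Lemma resolvent_open c : ~ spectrumA T c ->
  exists2 e : R, 0 < e & forall z, nrm (c - z) < e -> ~ spectrumA T z.
Proof.
move=> /resolvent_exists[S [K K0 [S1 S2 SK]]]; exists (2^-1 / K); first by rewrite divr_gt0.
move=> z zc; have small x : nrm ((z - c) *: S x) <= 2^-1 * nrm x.
  rewrite nrmZ; apply: le_trans (ler_wpM2l (nrm_ge0 _) (SK x)) _.
  by rewrite mulrA ler_wpM2r ?nrm_ge0 // -ler_pdivlMr // nrmB ltW.
have S_B x y : S (x - y) = S x - S y by rewrite -{1}(S1 x) -{1}(S1 y) -shiftB S2.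
apply/spectrumN_bij; split => [f|h h0].
  have [||x hx] := @neumann R A (fun x => (z - c) *: S x) _ _ f => //.
    by move=> x y; rewrite S_B scalerBr.
  by exists (S x); rewrite (shift_change z c) S1.
have e : shift c h = (z - c) *: h by apply/eqP; rewrite -subr_eq0 -shift_change h0.
have e2 : h = (z - c) *: S h.
  have SZ k x : S (k *: x) = k *: S x by rewrite -{1}(S1 x) -shiftZ S2.
  by rewrite -SZ -e S2.
by apply: nrm_le0; have := small h; rewrite -e2; have := nrm_ge0 h; lra.
Qed.

Lemma spectrum_bounded : exists M : R, forall z, spectrumA T z -> nrm z <= M.
Proof.
exists (2 * (`|KT| + 1)) => z; apply: contraPP => /negP; rewrite -ltNge => hz.
have K0 := normr_ge0 KT; have z0 : 0 < nrm z by lra.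
have zn : z != 0 by apply/eqP => e; rewrite e nrm0 ltxx in z0.
have small x : nrm (z^-1 *: T x) <= 2^-1 * nrm x.
  rewrite nrmZ nrmV ler_pdivrMl //; apply: le_trans (Tbnd x) _.
  rewrite mulrA ler_wpM2r ?nrm_ge0 //; have := ler_norm KT; lra.
have sh h : shift z h = (- z) *: (h - z^-1 *: T h).
  by rewrite /shift scalerBr scalerA mulNr mulfV // !scaleNr scale1r opprK addrC.
apply/spectrumN_bij; split => [f|h].
  have [||x hx] := @neumann R A (fun x => z^-1 *: T x) _ _ ((- z)^-1 *: f) => //.
    by move=> x y; rewrite TB scalerBr.
  by exists x; rewrite sh hx scalerA mulfV ?oppr_eq0 // scale1r.
rewrite sh => /eqP; rewrite scaler_eq0 oppr_eq0 (negbTE zn) /= subr_eq0 => /eqP e.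
by apply: nrm_le0; have := small h; rewrite -e; have := nrm_ge0 h; lra.
Qed.

Variable Rz : C -> A -> A.
Hypothesis RzP : forall z, ~ spectrumA T z -> forall f, shift z (Rz z f) = f.

Let shift_inj z x y : ~ spectrumA T z -> shift z x = shift z y -> x = y.
Proof.
move=> /spectrumN_bij[_ inj] e; apply/eqP; rewrite -subr_eq0; apply/eqP/inj.
by rewrite shiftB e subrr.
Qed.

Lemma resolvent_identity z z' f : ~ spectrumA T z -> ~ spectrumA T z' ->
  Rz z f - Rz z' f = (z - z') *: Rz z (Rz z' f).
Proof.
move=> hz hz'; apply: (shift_inj hz); rewrite shiftB shiftZ !RzP //.
by rewrite (shift_change z z') RzP // opprB addrCA subrr addr0.
Qed.

(** Near [c] the resolvents are bounded by twice the bound at [c]; the resolvent identity turns this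
    bound into a Lipschitz estimate. *)
Lemma resolvent_loclip c f : ~ spectrumA T c -> loclip (fun z => Rz z f) c.
Proof.
move=> hc; have [e e0 he] := resolvent_open hc.
have [S [K K0 [S1 S2 SK]]] := resolvent_exists hc.
have RS g : Rz c g = S g by apply: (shift_inj hc); rewrite RzP // S1.
have k2 : 0 < 2^-1 / K by rewrite divr_gt0.
exists (Num.min e (2^-1 / K)); first by rewrite lt_min e0.
have near z : nrm (z - c) < Num.min e (2^-1 / K) ->
    ~ spectrumA T z /\ forall g, nrm (Rz z g) <= 2 * K * nrm g.
  rewrite lt_min => /andP[z1 z2]; have hz : ~ spectrumA T z by apply: he; rewrite nrmB.
  split => // g; have := resolvent_identity g hc hz; rewrite !RS => id.
  have h1 : Rz z g = S g - (c - z) *: S (Rz z g) by rewrite -id opprB addrCA subrr addr0.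
  have := nrmBD (S g) ((c - z) *: S (Rz z g)); rewrite -h1 nrmZ nrmB.
  have := ler_wpM2l (nrm_ge0 (z - c)) (SK (Rz z g)).
  have : nrm (z - c) * K <= 2^-1 by rewrite -ler_pdivlMr // ltW.
  move=> /(ler_wpM2r (nrm_ge0 (Rz z g))); have := SK g; rewrite !mulrA; lra.
exists (2 * K * (2 * K) * nrm f) => z z' /near[hz bz] /near[hz' bz'].
rewrite resolvent_identity // nrmZ mulrC ler_wpM2r ?nrm_ge0 //.
have K2 : 0 <= 2 * K by lra.
have := ler_wpM2l K2 (bz' f); have := bz (Rz z' f); lra.
Qed.

End Resolvent.

Section PoleScale.
Variables (R : realType) (A : completeNormedModType (Cplx R)).
Local Notation C := (Cplx R).

Lemma pole_diff (l z c : C) : z != l -> c != l -> (z - l)^-1 - (c - l)^-1 = (c - z) * ((z - l)^-1 * (c - l)^-1).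
Proof.
rewrite -subr_eq0 => zl; rewrite -subr_eq0 => cl; field.
by rewrite zl cl.
Qed.

Lemma pole_near (l z c : C) : c != l -> nrm (z - c) < nrm (c - l) / 2 ->
  z != l /\ nrm (z - l)^-1 <= 2 / nrm (c - l).
Proof.
move=> cl h; have c0 : 0 < nrm (c - l) by apply: nrm_pos; rewrite subr_eq0.
have zl : nrm (c - l) / 2 <= nrm (z - l).
  by have := nrm_trans z c l; rewrite (nrmB c z); lra.
split; first by apply/eqP => e; rewrite e subrr nrm0 in zl; lra.
rewrite nrmV ler_pdivlMr // mulrC ler_pdivrMr; lra.
Qed.

Lemma pole_scale_loclip (l c : C) (x : C -> A) : c != l -> loclip x c ->
  loclip (fun z => (z - l)^-1 *: x z) c.
Proof.
move=> cl [d d0 [M hM]]; have c0 : 0 < nrm (c - l) by apply: nrm_pos; rewrite subr_eq0.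
set q := nrm (c - l) in c0; pose D := Num.min d (Num.min 1 (q / 2)).
have D0 : 0 < D by rewrite !lt_min d0 ltr01 divr_gt0.
exists D => //; pose Mx := nrm (x c) + `|M|.
exists (2 / q * `|M| + 2 / q * (2 / q) * Mx) => z z'.
rewrite !lt_min => /andP[z1 /andP[z2 z3]] /andP[z'1 /andP[z'2 z'3]].
have [zl bz] := pole_near cl z3; have [zl' bz'] := pole_near cl z'3.
have hM' u v : nrm (u - c) < d -> nrm (v - c) < d -> nrm (x u - x v) <= `|M| * nrm (u - v).
  by move=> h1 h2; apply: le_trans (hM _ _ h1 h2) _; rewrite ler_wpM2r ?nrm_ge0 ?ler_norm.
have xz' : nrm (x z') <= Mx.
  have cc : nrm (c - c) < d by rewrite subrr nrm0.
  have := hM' _ _ z'1 cc; have := nrmD (x z' - x c) (x c); rewrite subrK /Mx.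
  have := ler_wpM2l (normr_ge0 M) (ltW z'2); lra.
have -> : (z - l)^-1 *: x z - (z' - l)^-1 *: x z' =
    (z - l)^-1 *: (x z - x z') + ((z - l)^-1 - (z' - l)^-1) *: x z'.
  by rewrite scalerBr scalerBl addrA subrK.
have q2 : 0 <= 2 / q by rewrite divr_ge0 // ltW.
have h1 : nrm ((z - l)^-1 *: (x z - x z')) <= 2 / q * (`|M| * nrm (z - z')).
  by rewrite nrmZ; apply: ler_pM; rewrite ?nrm_ge0 //; exact: hM'.
have h2 : nrm (((z - l)^-1 - (z' - l)^-1) *: x z') <= nrm (z - z') * (2 / q * (2 / q)) * Mx.
  rewrite nrmZ; apply: ler_pM; rewrite ?nrm_ge0 // pole_diff // nrmM (nrmB z' z).
  rewrite ler_wpM2l ?nrm_ge0 // nrmM.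
  by apply: ler_pM; rewrite ?nrm_ge0.
apply: le_trans (nrmD _ _) _; apply: le_trans (lerD h1 h2) _; lra.
Qed.

Lemma nrm_seminorm (V : normedModType C) : seminorm (@nrm R V).
Proof. by split=> [x y|a x]; [exact: nrmD|rewrite nrmZ]. Qed.

Lemma pole_pdiff (l c : C) : c != l -> pdiff (@nrm R C : C^o -> R) (pole l) c.
Proof.
move=> cl; have c0 : 0 < nrm (c - l) by apply: nrm_pos; rewrite subr_eq0.
exists (- (c - l)^-1 ^+ 2) => e e0; set q := nrm (c - l) in c0.
have q3 : 0 < 2 / q * q^-1 ^+ 2 by rewrite mulr_gt0 ?divr_gt0 ?exprn_gt0 ?invr_gt0.
exists (Num.min (q / 2) (e / (2 / q * q^-1 ^+ 2))); first by rewrite lt_min !divr_gt0.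
move=> z; rewrite lt_min => /andP[z1 z2]; have [zl bz] := pole_near cl z1.
rewrite /pole; have -> : (z - l)^-1 - ((c - l)^-1 + (z - c) *: (- (c - l)^-1 ^+ 2 : C^o)) =
    (z - c) * ((z - c) * ((z - l)^-1 * (c - l)^-1 ^+ 2)).
  rewrite /GRing.scale /=; field; by rewrite !subr_eq0 zl cl.
rewrite nrmM mulrC ler_wpM2r ?nrm_ge0 // (nrmM (z - c)) (nrmM (z - l)^-1) nrmX (nrmV (c - l)).
apply: le_trans (_ : nrm (z - c) * (2 / q * q^-1 ^+ 2) <= _).
  apply: ler_wpM2l; first exact: nrm_ge0.
  by apply: ler_wpM2r => //; rewrite exprn_ge0 // invr_ge0 nrm_ge0.
by rewrite -ler_pdivlMr // ltW.
Qed.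

End PoleScale.

(** * Resolvents of the weighted composition operator on the boundary functions *)

Section CheckSpace.
Variables (R : realType) (A : completeNormedModType (Cplx R)).
Local Notation C := (Cplx R).
Variables (mul : A -> A -> A) (one : A) (U : A -> A) (w : A).
Hypothesis algA : is_unital_comm_banach_algebra mul one.
Hypothesis ssA : semisimple mul one.
Local Notation chk := (@in_checkA R A mul one).
Local Notation bd := (@shilov_boundary R A mul one).
Local Notation Tc := (check_wcomp w U).

Lemma chk_elt (f : A) : chk (fun t => t f).
Proof. by move=> e e0; exists f => t _; rewrite nrm_le subrr nrm0 ltW. Qed.

Lemma chk_sub (a : C) g h : chk g -> chk h -> chk (fun t => g t - a * h t).
Proof.
move=> hg hh e e0; have a1 : 0 < nrm a + 1 by have := nrm_ge0 a; lra.
have e2 : 0 < e / 2 by lra.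
have [f hf] := hg _ e2; have [f' hf'] := hh _ (divr_gt0 e2 a1).
exists (f - a *: f') => t bt; rewrite nrm_le.
have ct := shilov_character algA ssA bt.
rewrite (character_sub _ _ ct) (character_scale _ _ ct).
have -> : t f - a * t f' - (g t - a * h t) = (t f - g t) - a * (t f' - h t) by ring.
apply: le_trans (nrmBD _ _) _; rewrite nrmM.
have := hf t bt; have := hf' t bt; rewrite !nrm_le => h1 h2.
have : nrm a * nrm (t f' - h t) <= (nrm a + 1) * (e / 2 / (nrm a + 1)).
  by apply: ler_pM; rewrite ?nrm_ge0 //; lra.
rewrite [X in _ <= X -> _]mulrC divfK ?gt_eqF //; lra.
Qed.

Lemma chk_bdd g : chk g -> exists2 M : R, 0 <= M & forall t, bd t -> nrm (g t) <= M.
Proof.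
move=> hg; have [f hf] := hg _ (ltr01 : 0 < 1 :> R); exists (2 * nrm f + 1).
  by have := nrm_ge0 f; lra.
move=> t bt; have := hf t bt; rewrite nrm_le nrmB.
have := nrmD (g t - t f) (t f); rewrite subrK.
have := character_bound algA f (shilov_character algA ssA bt); lra.
Qed.

(** A witness against membership in [spectrum_checkA], with a positive real constant in the bound
    and with equalities unfolded to the boundary. *)
Definition check_resolvent l (S : ((A -> C) -> C) -> (A -> C) -> C) :=
  [/\ forall g, chk g -> chk (S g),
      forall g h, chk g -> (forall t, bd t -> g t = h t) -> forall t, bd t -> S g t = S h t,
      exists2 K : R, 0 < K & forall g M, 0 <= M -> chk g -> (forall t, bd t -> nrm (g t) <= M) ->
        forall t, bd t -> nrm (S g t) <= K * M,
      forall g, chk g -> forall t, bd t -> S (fun t => Tc g t - l * g t) t = g t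
    & forall g, chk g -> forall t, bd t -> Tc (S g) t - l * S g t = g t].

Lemma check_resolvent_exists l : ~ spectrum_checkA mul one Tc l -> exists S, check_resolvent l S.
Proof.
move=> /contrapT[S [S1 S2 [K hK] S4 S5]]; exists S; split => //.
exists (`|cre K| + 1); first by have := normr_ge0 (cre K); lra.
move=> g M M0 cg gM t bt; have : bdd_by mul one g (rc M) by move=> t' /gM; rewrite nrm_le.
move=> /(hK g _ cg) /(_ t bt) /cre_le; rewrite creM cre_rc cim_rc mulr0 subr0 => h.
by apply: le_trans h _; rewrite ler_wpM2r //; have := ler_norm (cre K); lra.
Qed.

Section Identities.
Variables (l k : C) (S S' : ((A -> C) -> C) -> (A -> C) -> C).
Hypothesis HS : check_resolvent l S.
Hypothesis HS' : check_resolvent k S'.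

Lemma check_resolvent_unique g h : chk g -> chk h -> (forall t, bd t -> Tc h t - l * h t = g t) ->
  forall t, bd t -> S g t = h t.
Proof.
have [_ S2 _ S4 _] := HS; move=> cg ch e t bt; rewrite -(S4 h ch t bt).
by apply: S2 => // t' bt'; rewrite e.
Qed.

Lemma check_resolvent_identity g : chk g -> forall t, bd t ->
  S g t - S' g t = (l - k) * S (S' g) t.
Proof.
have [S1 S2 _ S4 S5] := HS; have [S'1 _ _ _ S'5] := HS'.
move=> cg t bt; have cu := S'1 _ cg; have c1 := S1 _ cg; have c2 := S1 _ cu.
apply/eqP; rewrite subr_eq addrC -subr_eq eq_sym; apply/eqP.
transitivity (S (fun t => g t - (l - k) * S' g t) t).
  apply/esym; apply: check_resolvent_unique => //; first exact: chk_sub.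
  move=> t' bt'; rewrite -(S'5 g cg t' bt'); ring.
apply: (check_resolvent_unique (h := fun t => S g t - (l - k) * S (S' g) t)) => //; [exact: chk_sub|exact: chk_sub|].
move=> t' bt'; rewrite -(S5 g cg t' bt') -[in RHS](S5 _ cu t' bt') /check_wcomp; ring.
Qed.

End Identities.

(** The bound of S' is not uniform in z, so it is bootstrapped: the resolvent identity improves a
    bound 2 K M + B to 2 K M + B / 2, and iteration removes B. *)
Lemma check_resolvent_near c S K : check_resolvent c S -> 0 < K ->
  (forall g M, 0 <= M -> chk g -> (forall t, bd t -> nrm (g t) <= M) ->
        forall t, bd t -> nrm (S g t) <= K * M) ->
  forall z S', check_resolvent z S' -> nrm (z - c) * K <= 2^-1 ->
  forall g M, 0 <= M -> chk g -> (forall t, bd t -> nrm (g t) <= M) ->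
  forall t, bd t -> nrm (S' g t) <= 2 * K * M.
Proof.
move=> HS K0 SK z S' HS' zc g M M0 cg gM t bt.
have [S1 _ _ _ _] := HS; have [S'1 _ [K' K'0 S'K] _ _] := HS'.
have KM0 : 0 <= K * M by rewrite mulr_ge0 // ltW.
have step B : 0 <= B -> (forall t, bd t -> nrm (S' g t) <= 2 * K * M + B) ->
    forall t, bd t -> nrm (S' g t) <= 2 * K * M + B / 2.
  move=> B0 hB t' bt'.
  have := check_resolvent_identity HS HS' cg bt' => id.
  have e : S' g t' = S g t' + (z - c) * S (S' g) t'.
    by rewrite -[X in X + _](subrK (S' g t')) id; ring.
  have b0 : 0 <= 2 * K * M + B by lra.
  have h1 := SK _ _ b0 (S'1 _ cg) hB t' bt'; have h2 := SK g M M0 cg gM t' bt'.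
  rewrite e; apply: le_trans (nrmD _ _) _; rewrite nrmM.
  have := ler_wpM2l (nrm_ge0 (z - c)) h1; have := ler_wpM2r b0 zc; lra.
pose B n := K' * M * (2^-1) ^+ n.
have B0 n : 0 <= B n by rewrite mulr_ge0 ?exprn_ge0 ?invr_ge0 // mulr_ge0 // ltW.
have hB n : forall t, bd t -> nrm (S' g t) <= 2 * K * M + B n.
  elim: n => [|n IH] t' bt'.
    by have := S'K g M M0 cg gM t' bt'; rewrite /B expr0; lra.
  by have := step _ (B0 n) IH t' bt'; rewrite /B exprSr mulrA.
apply/ler_addgt0Pr => e e0; have [N /(_ N (leqnn _)) hN] := half_expr_small (K' * M) e0.
by apply: le_trans (hB N t bt) _; rewrite lerD2l.
Qed.

Variables (Dom : set C) (Sz : C -> ((A -> C) -> C) -> (A -> C) -> C).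
Hypothesis SzP : forall z, Dom z -> check_resolvent z (Sz z).
Hypothesis Dom_open : forall z, Dom z -> exists2 e : R, 0 < e & forall z', nrm (z - z') < e -> Dom z'.

(** The derivative is the square of the resolvent at [c] applied to [g]. The identity, used for [g]
    and for its image [u], gives a remainder of second order, bounded by [check_resolvent_near]. *)
Lemma check_resolvent_pdiff g t c : chk g -> bd t -> Dom c ->
  pdiff (@nrm R C : C^o -> R) (fun z => Sz z g t : C^o) c.
Proof.
move=> cg bt Dc; have HS := SzP Dc; have [S1 _ [K K0 SK] _ _] := HS.
pose u := Sz c g; have cu : chk u by exact: S1.
pose v := Sz c u; have cv : chk v by exact: S1.
exists (v t) => e e0; have [e1 e10 he1] := Dom_open Dc.
have [M M0 vM] := chk_bdd cv.
have q0 : 0 < 2 * K * M + 1 by have := mulr_ge0 (ltW K0) M0; lra.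
exists (Num.min e1 (Num.min (2^-1 / K) (e / (2 * K * M + 1)))).
  by rewrite !lt_min e10 !divr_gt0.
move=> z; rewrite !lt_min => /andP[z1 /andP[z2 z3]].
have Dz : Dom z by apply: he1; rewrite nrmB.
have HSz := SzP Dz.
have i1 := check_resolvent_identity HSz HS cg bt.
have i2 := check_resolvent_identity HSz HS cu bt.
have -> : Sz z g t - (Sz c g t + (z - c) *: (v t : C^o)) = (z - c) * ((z - c) * Sz z v t).
  have -> : Sz z g t = Sz c g t + (z - c) * Sz z u t by rewrite -i1; ring.
  have -> : Sz z u t = v t + (z - c) * Sz z v t by rewrite -i2 /v; ring.
  rewrite /GRing.scale /=; ring.
rewrite nrmM mulrC ler_wpM2r ?nrm_ge0 // nrmM.
have zK : nrm (z - c) * K <= 2^-1 by rewrite -ler_pdivlMr // ltW.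
have := check_resolvent_near HS K0 SK HSz zK M0 cv vM bt => h.
apply: le_trans (_ : nrm (z - c) * (2 * K * M + 1) <= _).
  by apply: ler_wpM2l; [exact: nrm_ge0|lra].
by rewrite -ler_pdivlMr // ltW.
Qed.

End CheckSpace.

(** * Grid contours and the spectrum *)

Section Tends.
Variable R : realType.
Local Notation C := (Cplx R).
Variables (V : lmodType C) (p : V -> R).
Hypothesis ps : seminorm p.

Definition tends0 (u : nat -> V) :=
  forall e : R, 0 < e -> exists N, forall n, (N <= n)%N -> p (u n) <= e.

Lemma tends0D u v : tends0 u -> tends0 v -> tends0 (fun n => u n + v n).
Proof.
move=> hu hv e e0; have e2 : 0 < e / 2 by lra.
have [N1 h1] := hu _ e2; have [N2 h2] := hv _ e2; exists (maxn N1 N2) => n.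
rewrite geq_max => /andP[/h1 k1 /h2 k2]; apply: le_trans (ps.1 _ _) _; lra.
Qed.

Lemma tends0_0 : tends0 (fun=> 0).
Proof.
move=> e e0; exists 0%N => n _; have := ps.2 0 0; rewrite scale0r nrm0 mul0r.
by move=> /le_trans; apply; exact: ltW.
Qed.

Lemma tends0_sum2 N (u : nat -> nat -> nat -> V) :
  (forall i j, (i < N)%N -> (j < N)%N -> tends0 (u i j)) ->
  tends0 (fun n => \sum_(i < N) \sum_(j < N) u i j n).
Proof.
move=> h; apply: (Pd_sum tends0D tends0_0 (u := fun i n => \sum_(j < N) u i j n)) => i iN.
by apply: (Pd_sum tends0D tends0_0) => j jN; exact: h.
Qed.

End Tends.

Section Contour.
Variable R : realType.
Local Notation C := (Cplx R).
Variables (K F : set C) (l0 : C) (r : R) (N : nat).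
Hypothesis r0 : 0 < r.
Hypothesis Kl0 : K l0.
Hypothesis Kr : forall z, K z -> nrm (z - l0) < r.
Let s : R := 2 * r / N.+1%:R.
Hypothesis sep : forall p q, K p -> F q -> 2 * s < nrm (p - q).
Let X := grd (cre l0 - r) s.
Let Y := grd (cim l0 - r) s.

Let s0 : 0 < s. Proof. by rewrite divr_gt0 ?ltr0n // mulr_gt0. Qed.

Definition chi i j : bool := `[< exists z, K z /\ in_sq (X i) (Y j) s z >].
(** After cancellation this is the integral over the boundary of the union of the squares meeting
    [K]. Kept as a sum over squares, it is accessible to Goursat's theorem cell by cell. *)
Definition gsum (V : lmodType C) n (g : C -> V) : V :=
  \sum_(i < N.+1) \sum_(j < N.+1) (chi i j)%:R *: loop n g (X i) (Y j) s.

(** Two points of a square are at distance at most [2 * s], which is the constant in [sep]. *)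
Lemma chi_notF i j z : chi i j -> in_sq (X i) (Y j) s z -> ~ F z.
Proof.
move=> /asboolP[p [Kp pQ]] zQ Fz; have := sep Kp Fz; have := in_sq_dist pQ zQ; lra.
Qed.

Lemma chi_notK i j z : ~~ chi i j -> in_sq (X i) (Y j) s z -> ~ K z.
Proof. by move=> /asboolP h zQ Kz; apply: h; exists z. Qed.

Let XN : X N.+1 = cre l0 + r.
Proof. by rewrite /X /grd /s mulrCA divff ?mulr1 ?pnatr_eq0 //; lra. Qed.
Let YN : Y N.+1 = cim l0 + r.
Proof. by rewrite /Y /grd /s mulrCA divff ?mulr1 ?pnatr_eq0 //; lra. Qed.

Let far_notK z : r <= `|cre z - cre l0| \/ r <= `|cim z - cim l0| -> ~ K z.
Proof.
move=> h /Kr; apply/negP; rewrite -leNgt.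
have := cre_le_nrm (z - l0); have := cim_le_nrm (z - l0); rewrite !cE.
by case: h; lra.
Qed.

Let bool_neq (b b' : bool) : (b%:R : C) != b'%:R -> b /\ ~~ b' \/ ~~ b /\ b'.
Proof. by case: b b' => -[] //=; rewrite ?eqxx //; [left|right]. Qed.

Let bool_neq0 (b : bool) : (b%:R : C) != 0 -> b.
Proof. by case: b => //; rewrite eqxx. Qed.

Section Closed.
Variables (V : lmodType C) (Pd : (nat -> V) -> Prop) (g : C -> V).
Hypothesis PdD : forall u v, Pd u -> Pd v -> Pd (fun n => u n + v n).
Hypothesis PdZ : forall (k : C) u, Pd u -> Pd (fun n => k *: u n).
Hypothesis Pd0 : Pd (fun=> 0).
Hypothesis Pd_seg : forall a b, (forall t : R, 0 <= t -> t <= 1 ->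
   let z := a + rc t * (b - a) in ~ K z /\ ~ F z) -> Pd (fun n => midint n g a b).

Let Pd_hor x y : (forall z, x <= cre z -> cre z <= x + s -> cim z = y -> ~ K z /\ ~ F z) ->
  Pd (fun n => hor n g x y s).
Proof.
move=> h; apply: Pd_seg => t t0 t1; have := mulr_ge0 t0 (ltW s0); have := ler_wpM2r (ltW s0) t1 => h1 h2.
by apply: h; rewrite !cE; lra.
Qed.

Let Pd_ver x y : (forall z, y <= cim z -> cim z <= y + s -> cre z = x -> ~ K z /\ ~ F z) ->
  Pd (fun n => ver n g x y s).
Proof.
move=> h; apply: Pd_seg => t t0 t1; have := mulr_ge0 t0 (ltW s0); have := ler_wpM2r (ltW s0) t1 => h1 h2.
by apply: h; rewrite !cE; lra.
Qed.

(* After summation by parts only the edges between a square meeting K and one missing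
   K contribute; these avoid both K and F. *)
Lemma gsum_closed : Pd (fun n => gsum n g).
Proof.
have r_le (a b : R) : a = b - r \/ a = b + r -> r <= `|a - b|.
  by case=> ->; [have := ler_norm (- (b - r - b)); rewrite normrN|have := ler_norm (b + r - b)]; lra.
have Y0 : Y 0%N = cim l0 - r by rewrite /Y /grd mul0r addr0.
have X0 : X 0%N = cre l0 - r by rewrite /X /grd mul0r addr0.
have edge i j z : chi i j -> in_sq (X i) (Y j) s z -> ~ K z -> ~ K z /\ ~ F z.
  by move=> c zQ nK; split => //; exact: chi_notF zQ.
apply: (grid_closed PdD PdZ Pd0 (g := g) (c := fun i j => (chi i j)%:R)) => i iN; split.
- move=> /bool_neq0 c; apply: Pd_hor => z h1 h2 h3; apply: (edge i 0%N) => //.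
    by split; rewrite ?Y0 ?h3 //; lra.
  by apply: far_notK; right; apply: r_le; left; rewrite h3.
- move=> /bool_neq0 c; apply: Pd_hor => z h1 h2 h3; apply: (edge i N) => //.
    have h4 : cim z = Y N + s by rewrite h3; exact: grdS.
    by split => //; rewrite h4; lra.
  by apply: far_notK; right; apply: r_le; right; rewrite h3 -/Y YN.
- move=> j jN /bool_neq h; apply: Pd_hor => z h1 h2 h3.
  have h5 : cim z = Y j.+1 by exact: h3.
  have q1 : in_sq (X i) (Y j.+1) s z by split => //; rewrite h5; lra.
  have q2 : in_sq (X i) (Y j) s z.
    have h4 : cim z = Y j + s by rewrite h3; exact: grdS.
    by split => //; rewrite h4; lra.
  case: h => -[a b]; first by apply: (edge i j) => //; exact: chi_notK q1.
  by apply: (edge i j.+1) => //; exact: chi_notK q2.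
- move=> /bool_neq0 c; apply: Pd_ver => z h1 h2 h3; apply: (edge 0%N i) => //.
    by split; rewrite ?X0 ?h3 //; lra.
  by apply: far_notK; left; apply: r_le; left; rewrite h3.
- move=> /bool_neq0 c; apply: Pd_ver => z h1 h2 h3; apply: (edge N i) => //.
    have h4 : cre z = X N + s by rewrite h3; exact: grdS.
    by split => //; rewrite h4; lra.
  by apply: far_notK; left; apply: r_le; right; rewrite h3 -/X XN.
- move=> j jN /bool_neq h; apply: Pd_ver => z h1 h2 h3.
  have h5 : cre z = X j.+1 by exact: h3.
  have q1 : in_sq (X j.+1) (Y i) s z by split => //; rewrite h5; lra.
  have q2 : in_sq (X j) (Y i) s z.
    have h4 : cre z = X j + s by rewrite h3; exact: grdS.
    by split => //; rewrite h4; lra.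
  case: h => -[a b]; first by apply: (edge j i) => //; exact: chi_notK q1.
  by apply: (edge j.+1 i) => //; exact: chi_notK q2.
Qed.

End Closed.

Lemma gsumD (V : lmodType C) n (g g' : C -> V) :
  gsum n (fun z => g z + g' z) = gsum n g + gsum n g'.
Proof.
rewrite -big_split; apply: eq_bigr => i _; rewrite -big_split; apply: eq_bigr => j _.
by rewrite loopD scalerDr.
Qed.

Lemma gsumN (V : lmodType C) n (g : C -> V) : gsum n (fun z => - g z) = - gsum n g.
Proof.
rewrite -sumrN; apply: eq_bigr => i _; rewrite -sumrN; apply: eq_bigr => j _.
by rewrite loopN scalerN.
Qed.

Lemma gsum_scal (V : lmodType C) n (k : C -> C) (v : V) :
  gsum n (fun z => k z *: v) = gsum n (k : C -> C^o) *: v.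
Proof.
rewrite scaler_suml; apply: eq_bigr => i _; rewrite scaler_suml; apply: eq_bigr => j _.
by rewrite loop_scal scalerA.
Qed.

Lemma gsum_lin (V W : lmodType C) (L : V -> W) n g :
  (forall (k : C) x y, L (k *: x + y) = k *: L x + L y) ->
  L (gsum n g) = gsum n (fun z => L (g z)).
Proof.
move=> Ll; have LD u v : L (u + v) = L u + L v by have := Ll 1 u v; rewrite !scale1r.
have L0 : L 0 = 0 by apply: (addrI (L 0)); rewrite -LD !addr0.
have LZ k x : L (k *: x) = k *: L x by have := Ll k x 0; rewrite L0 !addr0.
rewrite (big_morph L LD L0); apply: eq_bigr => i _.
rewrite (big_morph L LD L0); apply: eq_bigr => j _.
by rewrite LZ (loop_lin _ _ _ _ _ Ll).
Qed.

(** The functions may differ on [K], inside the contour: [gsum_closed], for the property of being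
    identically zero, leaves only edges where g - g' vanishes. This allows a resolvent with
    arbitrary values on [K] to be exchanged for a holomorphic function. *)
Lemma gsum_eq (V : lmodType C) n (g g' : C -> V) :
  (forall z, ~ K z -> ~ F z -> g z = g' z) -> gsum n g = gsum n g'.
Proof.
move=> e; apply/eqP; rewrite -subr_eq0 -gsumN -gsumD; apply/eqP.
move: n; pose Pd (u : nat -> V) := forall n, u n = 0.
suff : Pd (fun n => gsum n (fun z => g z - g' z)) by [].
apply: gsum_closed => [u v hu hv n|k u hu n|//|a b hab n].
- by rewrite hu hv addr0.
- by rewrite hu scaler0.
have Sc : midconvex (fun z : C => exists t : R, [/\ 0 <= t, t <= 1 & z = a + rc t * (b - a)]).
  move=> z w [t [t0 t1 ->]] [u [u0 u1 ->]]; exists ((t + u) / 2); split; [lra|lra|].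
  by apply: cplx_eqP; rewrite !cE; field.
have := @eq_midint R V _ n (fun z => g z - g' z) (fun=> 0 *: (0 : V)) a b Sc.
move=> ->; first by rewrite (midint_scal n (fun=> 0)) scaler0.
- by exists 0; split => //; rewrite rc0 mul0r addr0.
- by exists 1; split => //; rewrite rc1 mul1r subrKC.
move=> z [t [t0 t1 ->]]; have [h1 h2] := hab t t0 t1.
by rewrite (e _ h1 h2) subrr scaler0.
Qed.

(** The marked squares avoid [F], so every one of them lies where [g] is differentiable. *)
Lemma gsum_goursat (V : lmodType C) (p : V -> R) g : seminorm p ->
  (forall z, ~ F z -> pdiff p g z) -> tends0 p (fun n => gsum n g).
Proof.
move=> ps hg.
apply: (tends0_sum2 ps (u := fun i j n => (chi i j)%:R *: loop n g (X i) (Y j) s)) => i j _ _.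
case hc : (chi i j); last by under eq_fun do rewrite scale0r; exact: tends0_0.
under eq_fun do rewrite scale1r.
by move=> e e0; apply: goursat => // c cQ; apply: hg; exact: chi_notF cQ.
Qed.

(** The whole grid gives at least 4. The unmarked squares miss [K], hence [l0], and their total is
    at most 1 from some level on. *)
Lemma gsum_pole : exists N0, forall n, (N0 <= n)%N -> 3 <= cim (gsum n (pole l0)).
Proof.
have ps := @nrm_seminorm R C.
have [|N0 hN0] := @tends0_sum2 R C^o (@nrm R C) ps N.+1
   (fun i j n => (1 - (chi i j)%:R) *: loop n (pole l0) (X i) (Y j) s) _ 1 ltr01.
  move=> i j _ _; case hc : (chi i j).
    by rewrite subrr; under eq_fun do rewrite scale0r; exact: tends0_0.
  rewrite subr0; under eq_fun do rewrite scale1r.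
  move=> e e0; apply: goursat => // c cQ; apply: pole_pdiff; apply/eqP => e1.
  by have := chi_notK (negbT hc) cQ; rewrite e1.
exists N0 => n /hN0 h; have := grid_pole n N l0 r0 => /=; rewrite -/s -/X -/Y.
have -> : \sum_(i < N.+1) \sum_(j < N.+1) loop n (pole l0) (X i) (Y j) s =
   gsum n (pole l0) + \sum_(i < N.+1) \sum_(j < N.+1) (1 - (chi i j)%:R) *: loop n (pole l0) (X i) (Y j) s.
  rewrite -big_split; apply: eq_bigr => i _; rewrite -big_split; apply: eq_bigr => j _.
  by rewrite /= -scalerDl addrCA subrr addr0 scale1r.
rewrite cimD; set q := (\sum_(i < N.+1) _ : C) in h *.
have := cim_le_nrm q; have := ler_norm (cim q); move: h; lra.
Qed.

End Contour.

(** * Isolated parts of the spectrum of the weighted composition operator *)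

Section SpectralSubset.
Variables (R : realType) (A : completeNormedModType (Cplx R)).
Local Notation C := (Cplx R).
Variables (mul : A -> A -> A) (one : A) (U : A -> A) (w : A).
Hypothesis algA : is_unital_comm_banach_algebra mul one.
Hypothesis ssA : semisimple mul one.
Hypothesis autU : is_automorphism mul one U.
Local Notation T := (wcomp mul w U).
Local Notation bd := (@shilov_boundary R A mul one).

Lemma wcomp_lin (k : C) x y : T (k *: x + y) = k *: T x + T y.
Proof. by have [Ul _ _ _] := autU; rewrite /wcomp Ul (bmulDr algA) (bmulZr algA). Qed.

Lemma character_comp m : is_character mul one m -> is_character mul one (m \o U).
Proof.
have [Ul Um U1 _] := autU; move=> [ml mm m1]; split => /=.
- by move=> a x y; rewrite Ul ml.
- by move=> x y; rewrite Um mm.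
- by rewrite U1.
Qed.

Lemma character_cvto m (u : nat -> A) x : is_character mul one m -> cvto u x ->
  cvto (fun n => m (u n)) (m x).
Proof.
move=> cm; apply: (cvto_lip (K := 2)) => a b.
by rewrite -(character_sub _ _ cm); exact: (character_bound algA _ cm).
Qed.

(** Automatic continuity: [m \o U] is again a character, hence continuous, and characters separate
    points, so the graph is closed. *)
Lemma wcomp_bounded : exists K : R, forall x, nrm (T x) <= K * nrm x.
Proof.
apply: closed_graph; first exact: wcomp_lin.
move=> u x y ux Ty; apply/eqP; rewrite -subr_eq0; apply/eqP.
apply: (characters_separate algA ssA) => m cm; rewrite (character_sub _ _ cm).
have [_ mm _] := cm.
have h1 := character_cvto cm Ty.
have h2 := character_cvto (character_comp cm) ux.
have h3 : cvto (fun n => m (T (u n))) (m w * m (U x)).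
  apply: cvto_ext (fun n => esym (mm w (U (u n)))) _.
  apply: (cvto_lip (K := nrm (m w)) (f := fun a : C => m w * a)) h2 => a b.
  by rewrite -mulrBr nrmM.
by rewrite (cvto_unique h1 h3) /wcomp mm subrr.
Qed.

Variable Dom : set C.
Hypothesis Dom_open : forall z, Dom z -> exists2 e : R, 0 < e & forall z', nrm (z - z') < e -> Dom z'.
Hypothesis Dom_check : forall z, Dom z -> ~ spectrum_checkA mul one (check_wcomp w U) z.

Section Surjective.
Variables (K F : set C) (l0 : C) (r : R) (N : nat).
Hypothesis r0 : 0 < r.
Hypothesis Kl0 : K l0.
Hypothesis Kr : forall z, K z -> nrm (z - l0) < r.
Hypothesis sep : forall p q, K p -> F q -> 2 * (2 * r / N.+1%:R) < nrm (p - q).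
Hypothesis KF_rho : forall z, ~ K z -> ~ F z -> ~ spectrumA T z.
Hypothesis F_Dom : forall z, ~ F z -> Dom z.

Local Notation G := (gsum K l0 r N).

Lemma gsum_cvto (g : C -> A) : (forall z, ~ K z -> ~ F z -> loclip g z) ->
  exists l, cvto (fun n => G n g) l.
Proof.
move=> hg; pose Pd (u : nat -> A) := exists l, cvto u l.
apply: (gsum_closed r0 Kr sep (Pd := Pd)).
- by move=> u v [a ha] [b hb]; exists (a + b); exact: cvtoD.
- by move=> k u [a ha]; exists (k *: a); exact: cvtoZ.
- by exists 0; exact: cvto_cst.
- by move=> a b hab; apply: midint_cvto => t t0 t1; have [] := hab t t0 t1; exact: hg.
Qed.

(** Convergence is obtained in [A], for the pole times [one], and carried to [C] by a character. The
    limit is not 0 because the imaginary parts are eventually at least 3. *)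
Lemma pole_gsum_limit : exists2 c : C, c != 0 & cvto (fun n => (G n (pole l0) : C)) c.
Proof.
have [m cm] := character_exists algA ssA.
have [|y hy] := @gsum_cvto (fun z => pole l0 z *: one).
  move=> z nK _; apply: pole_scale_loclip; first by apply/eqP => e; apply: nK; rewrite e.
  by exists 1 => //; exists 0 => a b _ _; rewrite subrr nrm0 mul0r.
have hm : cvto (fun n => (G n (pole l0) : C)) (m y).
  apply: cvto_ext (character_cvto cm hy) => n.
  by rewrite gsum_scal (character_scale _ _ cm); have [_ _ ->] := cm; rewrite mulr1.
exists (m y) => //; apply/eqP => my0; rewrite my0 in hm.
have [N0 hN0] := @gsum_pole R K l0 r N r0 Kl0.
have [N1 hN1] := hm _ (ltr01 : 0 < 1 :> R).
have := hN0 _ (leq_maxl N0 N1); have := hN1 _ (leq_maxr N0 N1); rewrite subr0.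
have := cim_le_nrm (G (maxn N0 N1) (pole l0) : C).
have := ler_norm (cim (G (maxn N0 N1) (pole l0) : C)); lra.
Qed.

Lemma shift_surjective f : exists h, shift T l0 h = f.
Proof.
have [KT Tb] := wcomp_bounded.
(* On the spectrum [id] is a placeholder; the contour never sees it. *)
have exR z : exists S : A -> A, ~ spectrumA T z -> forall f, shift T z (S f) = f.
  have [hz|hz] := pselect (spectrumA T z); first by exists id.
  by have [S [_ _ [h _ _]]] := resolvent_exists hz; exists S.
have [Rz RzP] := choice exR.
have lipR z g : ~ K z -> ~ F z -> loclip (fun z => Rz z g) z.
  by move=> nK nF; apply: (resolvent_loclip wcomp_lin Tb RzP); exact: KF_rho.
have nl0 z : ~ K z -> z != l0 by move=> nK; apply/eqP => e; apply: nK; rewrite e.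
have [P hP] := gsum_cvto (fun z => lipR z f).
have [h hh] : exists h, cvto (fun n => G n (fun z => pole l0 z *: Rz z f)) h.
  apply: gsum_cvto => z nK nF; apply: pole_scale_loclip; first exact: nl0.
  exact: lipR.
have [c c0 hc] := pole_gsum_limit.
have P0 : P = 0.
  apply: (shilov_separate algA ssA) => t bt.
  have ct := shilov_character algA ssA bt; have [tl tm t1] := ct.
  have exS z : exists S, Dom z -> check_resolvent mul one U w z S.
    have [Dz|nD] := pselect (Dom z); last by exists (fun g => g).
    by have [S hS] := check_resolvent_exists (Dom_check Dz); exists S.
  have [Sz SzP] := choice exS.
  have tP := character_cvto ct hP.
  (* On the contour the image of R(z) f solves the equation that characterizes the resolvent on
     boundary functions. The right-hand side, unlike the left, is holomorphic across [K]. *)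
  have e n : t (G n (fun z => Rz z f)) = G n (fun z => Sz z (fun t => t f) t : C^o).
    rewrite (gsum_lin (W := C^o) K l0 r N n (fun z => Rz z f) tl).
    apply: (gsum_eq r0 Kr sep) => z nK nF; apply/esym.
    apply: (check_resolvent_unique (SzP _ (F_Dom nF)) (h := fun t => t (Rz z f)));
      rewrite ?chk_elt //; try exact: chk_elt.
    move=> t' bt'; have ct' := shilov_character algA ssA bt'.
    rewrite -[in RHS](RzP z (KF_rho nK nF) f) /shift (character_sub _ _ ct').
    by rewrite (character_scale _ _ ct') /wcomp; have [_ -> _] := ct'.
  have z0 : cvto (fun n => t (G n (fun z => Rz z f))) 0.
    have H : tends0 (@nrm R C : C^o -> R) (fun n => G n (fun z => Sz z (fun t => t f) t : C^o)).
      apply: (gsum_goursat l0 r0 sep (V := C^o) (p := @nrm R C) (@nrm_seminorm R C)) => z nF.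
      apply: (check_resolvent_pdiff algA ssA SzP Dom_open) => //; last exact: F_Dom.
      exact: chk_elt.
    apply: cvto_ext (fun n => esym (e n)) _ => d d0.
    have [N0 hN0] := H d d0.
    by exists N0 => n /hN0; rewrite subr0.
  exact: cvto_unique tP z0.
have key n : shift T l0 (G n (fun z => pole l0 z *: Rz z f)) =
    G n (pole l0) *: f + G n (fun z => Rz z f).
  rewrite (gsum_lin _ _ _ _ _ _ (shift_lin wcomp_lin l0)) -gsum_scal -gsumD.
  apply: (gsum_eq r0 Kr sep) => z nK nF.
  rewrite (shiftZ wcomp_lin) (shift_change T l0 z) RzP; last exact: KF_rho.
  rewrite scalerBr scalerA -(opprB z) mulrN /pole mulVf ?subr_eq0 ?nl0 //.
  by rewrite scaleN1r opprK.
have lim1 := shift_cvto wcomp_lin Tb l0 hh.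
have lim2 := cvtoD (cvtoZl f hc) hP; rewrite P0 addr0 in lim2.
have := cvto_unique lim1 (cvto_ext (fun n => esym (key n)) lim2) => eq1.
exists (c^-1 *: h); rewrite (shiftZ wcomp_lin) eq1 scalerA mulVf //.
exact: scale1r.
Qed.

End Surjective.

(** A point [l0] of [K] would not belong to the spectrum: [T] - l0 is onto by the contour integral,
    and injective because the operator on boundary functions is. The first two hypotheses say that
    [K] is closed and relatively open in the spectrum. *)
Lemma isolated_spectral_subset_empty (K : set C) :
  (forall z, ~ K z -> exists2 e : R, 0 < e & forall z', nrm (z - z') < e -> ~ K z') ->
  (forall z, K z -> exists2 e : R, 0 < e & forall z', nrm (z - z') < e -> spectrumA T z' -> K z') ->
  K `<=` spectrumA T -> K `<=` Dom -> forall z, ~ K z.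
Proof.
move=> cK oK Ks KD l0 Kl0; have [KT Tb] := wcomp_bounded.
(* Off [F] and off [K] the resolvent of [T] exists, and off [F] that of the boundary operator; [F]
   is closed since [K] is relatively open in the spectrum. *)
pose F : set C := [set z | spectrumA T z /\ ~ K z \/ ~ Dom z].
have KF z : K z -> ~ F z by move=> Kz [[]|] //; apply; exact: KD.
have cF z : ~ F z -> exists2 e : R, 0 < e & forall z', nrm (z - z') < e -> ~ F z'.
  move=> nF; have Dz : Dom z by apply: contrapT => nD; apply: nF; right.
  have [d d0 hd] := Dom_open Dz.
  have [e e0 he] : exists2 e : R, 0 < e & forall z', nrm (z - z') < e -> spectrumA T z' -> K z'.
    have [Kz|nK] := pselect (K z); first exact: oK.
    have [|e e0 he] := resolvent_open wcomp_lin Tb (c := z).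
      by move=> sz; apply: nF; left.
    by exists e => // z' /he.
  exists (Num.min d e); first by rewrite lt_min d0.
  move=> z'; rewrite lt_min => /andP[/hd Dz' /he h] [[sz nK]|//]; exact: nK (h sz).
have [M hM] := spectrum_bounded wcomp_lin Tb.
have M0 : 0 <= M by apply: le_trans (hM _ (Ks _ Kl0)); exact: nrm_ge0.
(* Two points of the spectrum are at distance at most [2 * M], so [K] stays strictly inside the
   grid. *)
pose r := 2 * M + 1; have r0 : 0 < r by rewrite /r; lra.
have Kr z : K z -> nrm (z - l0) < r.
  move=> Kz; apply: le_lt_trans (nrmBD _ _) _.
  by have := hM _ (Ks _ Kz); have := hM _ (Ks _ Kl0); rewrite /r; lra.
have r2 : 0 < 2 * r by lra.
have [d d0 hd] := set_separation (cre l0 - r) (cim l0 - r) r2 cK cF KF.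
(* Twice the mesh [2 * r / N.+1%:R] falls below the distance [d] between [K] and [F]. *)
pose N := Num.bound (4 * r / d).
have N1 : 4 * r / d < N.+1%:R.
  apply: (@lt_trans _ _ N%:R); last by rewrite ltr_nat.
  by apply: archi_boundP; rewrite divr_ge0 ?ltW //; lra.
have sep p q : K p -> F q -> 2 * (2 * r / N.+1%:R) < nrm (p - q).
  move=> Kp Fq; apply: (@lt_le_trans _ _ d); last first.
    apply: hd => //; have := Kr _ Kp => h.
    have := cre_le_nrm (p - l0); have := cim_le_nrm (p - l0); rewrite !cE !ler_norml.
    by move=> /andP[? ?] /andP[? ?]; split; lra.
  have -> : 2 * (2 * r / N.+1%:R) = 4 * r / N.+1%:R by rewrite !mulrA -natrM.
  by rewrite ltr_pdivrMr ?ltr0n // [d * _]mulrC -ltr_pdivrMr.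
have rho z : ~ K z -> ~ F z -> ~ spectrumA T z by move=> nK nF sz; apply: nF; left.
have FD z : ~ F z -> Dom z by move=> nF; apply: contrapT => nD; apply: nF; right.
have sur := shift_surjective r0 Kl0 Kr sep rho FD.
apply: (_ : ~ spectrumA T l0) (Ks _ Kl0); apply/(spectrumN_bij wcomp_lin Tb).
split=> [f|h h0]; first exact: sur.
have [S HS] := check_resolvent_exists (Dom_check (KD _ Kl0)).
apply: (shilov_separate algA ssA) => t bt.
(* Every element of the kernel has the same boundary values, those of the resolvent at the zero
   function, written [fun t => t 0]; this is compared for [h] and 0. *)
have elt x : shift T l0 x = 0 -> S (fun t => t 0) t = t x.
  move=> x0; apply: (check_resolvent_unique HS (h := fun t => t x)) => //; try exact: chk_elt.
  move=> t' bt'; have ct' := shilov_character algA ssA bt'.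
  rewrite -x0 /shift (character_sub _ _ ct') (character_scale _ _ ct') /wcomp.
  by have [_ -> _] := ct'.
have s0 : shift T l0 0 = 0 by have := shiftB wcomp_lin l0 0 0; rewrite !subrr.
have ct := shilov_character algA ssA bt.
by rewrite -(elt _ h0) (elt _ s0); have := character_sub 0 0 ct; rewrite !subrr.
Qed.

End SpectralSubset.

(** * The unit circle and the connectedness of the spectrum *)

Section UnitCircle.
Variable R : realType.
Local Notation C := (Cplx R).

Lemma unit_circleE (z : C) : unit_circle R z <-> nrm z = 1.
Proof.
rewrite /unit_circle /= nrmE -rc1; split => [/(congr1 (@cre R))|->] //.
Qed.

Lemma unit_circle_connected : connected (unit_circle R).
Proof.
pose f (t : R) : C := cpx (cos t) (sin t).
have -> : unit_circle R = [set f t | t in [set: R]].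
  apply/seteqP; split => [z /unit_circleE z1|_ [t _ <-]]; last first.
    apply/unit_circleE/eqP; rewrite -(eqrXn2 (n:=2)) ?nrm_ge0 // nrm_sqr !cE cos2Dsin2.
    by rewrite expr1n.
  have e : cre z ^+ 2 + cim z ^+ 2 = 1 by rewrite -nrm_sqr z1 expr1n.
  have cz : -1 <= cre z <= 1.
    by rewrite -ler_norml; apply: le_trans (cre_le_nrm z) _; rewrite z1.
  have e2 : cim z ^+ 2 = sin (acos (cre z)) ^+ 2.
    rewrite sin2cos2 acosK ?in_itv //= -e; ring.
  move/eqP: e2; rewrite eqf_sqr => /orP[/eqP h|/eqP h].
    by exists (acos (cre z)) => //; apply: cplx_eqP; rewrite !cE ?acosK ?in_itv.
  by exists (- acos (cre z)) => //; apply: cplx_eqP; rewrite !cE ?cosN ?sinN ?acosK ?in_itv.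
apply: connected_continuous_connected; first by apply/connected_intervalP => x y.
apply: continuous_subspaceT => t P /nbhs_nrmP[e e0 he].
have e2 : 0 < e / 2 by lra.
have /cvgrPdist_lt /(_ _ e2) hc := @continuous_cos R t.
have /cvgrPdist_lt /(_ _ e2) hs := @continuous_sin R t.
suff : \forall u \near t, P (f u) by [].
near=> u; apply: he; apply: le_lt_trans (nrm_le_reim _) _; rewrite /f !cE.
have h1 : `|cos t - cos u| < e / 2 by near: u.
have h2 : `|sin t - sin u| < e / 2 by near: u.
lra.
Unshelve. all: by end_near.
Qed.

End UnitCircle.

Theorem theorem4 (R : realType) (A : completeNormedModType (Cplx R))
  (mul : A -> A -> A) (one : A) (U : A -> A) (w : A) :
  is_unital_comm_banach_algebra mul one ->
  semisimple mul one ->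
  is_automorphism mul one U ->
  invertible mul one w ->
  spectrum_checkA mul one (check_wcomp w U) = unit_circle R ->
  unit_circle R `<=` spectrumA (wcomp mul w U) ->
  connected (spectrumA (wcomp mul w U)).
Proof.
move=> algA ssA autU _ checkE circ B [b0 Bb0] [G oO BO] [F cF BF].
set T := wcomp mul w U in BO BF circ *.
set sp := spectrumA T in BO BF circ *.
have [KT Tb] := wcomp_bounded w algA ssA autU.
have Tlin := wcomp_lin w algA autU.
have rho_open z : ~ sp z -> exists2 e : R, 0 < e & forall z', nrm (z - z') < e -> ~ sp z'.
  by exact: (resolvent_open Tlin Tb).
have chk z : nrm z != 1 -> ~ spectrum_checkA mul one (check_wcomp w U) z.
  by rewrite checkE => z1 /unit_circleE e; rewrite e eqxx in z1.
pose inner : set (Cplx R) := [set z | nrm z < 1].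
pose outer : set (Cplx R) := [set z | 1 < nrm z].
have dist (z z' : Cplx R) : nrm z <= nrm z' + nrm (z - z') /\ nrm z' <= nrm z + nrm (z - z').
  have := nrmD (z - z') z'; have := nrmD (z' - z) z; rewrite !subrK (nrmB z' z); lra.
have inner_open z : inner z -> exists2 e : R, 0 < e & forall z', nrm (z - z') < e -> inner z'.
  rewrite /inner /= => z1; exists (1 - nrm z); first by lra.
  by move=> z' h; have [_] := dist z z'; lra.
have outer_open z : outer z -> exists2 e : R, 0 < e & forall z', nrm (z - z') < e -> outer z'.
  rewrite /outer /= => z1; exists (nrm z - 1); first by lra.
  by move=> z' h; have [+ _] := dist z z'; lra.
(* A relatively clopen part of the spectrum that avoids the circle is empty. Its portions inside and
   outside the circle are treated separately, each in an open set where the boundary operator minus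
   z is invertible. *)
have clopen_empty (O' F' K : set (Cplx R)) : open O' -> closed F' -> K = sp `&` O' -> K = sp `&` F' ->
    (forall z, K z -> nrm z != 1) -> forall z, ~ K z.
  move=> oO' cF' KO KF K1.
  have part (D D' : set (Cplx R)) :
     (forall z, D z -> exists2 e : R, 0 < e & forall z', nrm (z - z') < e -> D z') ->
     (forall z, D' z -> exists2 e : R, 0 < e & forall z', nrm (z - z') < e -> D' z') ->
     (forall z, D z -> ~ D' z) -> (forall z, nrm z != 1 -> ~ D z -> D' z) ->
     (forall z, D z -> nrm z != 1) -> forall z, ~ (K `&` D) z.
    move=> Do D'o DD' cov D1.
    apply: (isolated_spectral_subset_empty algA ssA autU (w := w) Do).
    - by move=> z /D1; exact: chk.
    (* A point of [K] outside [D] lies on the other side of the circle, in the open set [D']. *)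
    - move=> z nKD; have [Kz|nK] := pselect (K z).
        have [|e e0 he] := D'o z; first by apply: cov; [exact: K1|move=> Dz; exact: nKD].
        by exists e => // z' /he D'z [_ /DD'].
      have [sz|nsz] := pselect (sp z); last first.
        have [e e0 he] := rho_open _ nsz; exists e => // z' /he nsz' [Kz' _].
        by apply: nsz'; move: Kz'; rewrite KO => -[].
      have nF : (~` F') z by move=> Fz; apply: nK; rewrite KF.
      have /open_nrmP /(_ _ nF) [e e0 he] : open (~` F') by exact: closed_openC.
      by exists e => // z' /he nF' [Kz' _]; apply: nF'; move: Kz'; rewrite KF => -[].
    - move=> z [Kz Dz]; have Oz : O' z by move: Kz; rewrite KO => -[].
      have /open_nrmP /(_ _ Oz) [e e0 he] := oO'; have [d d0 hd] := Do z Dz.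
      exists (Num.min e d); first by rewrite lt_min e0.
      by move=> z'; rewrite lt_min => /andP[/he Oz' /hd Dz'] sz'; split => //; rewrite KO.
    - by move=> z [+ _]; rewrite KO => -[].
    - by move=> z [].
  move=> z Kz; have : nrm z < 1 \/ 1 < nrm z by apply/orP; rewrite -neq_lt; exact: K1.
  case=> h.
    apply: (part inner outer inner_open outer_open) => //.
    - by move=> u; rewrite /inner /outer /=; lra.
    - by move=> u; rewrite neq_lt => /orP[].
    - by move=> u; rewrite /inner /= => /lt_eqF ->.
    - by split; [exact: Kz|].
  apply: (part outer inner outer_open inner_open) => //.
  - by move=> u; rewrite /inner /outer /=; lra.
  - by move=> u; rewrite neq_lt => /orP[].
  - by move=> u; rewrite /outer /= => /gt_eqF ->.
  - by split; [exact: Kz|].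
(* If [B] misses the circle it is empty, against [b0]. *)
have [hB|hB] := pselect (unit_circle R `&` B !=set0); last first.
  case: (clopen_empty G F B oO cF BO BF _ b0 Bb0) => z Bz.
  by apply/eqP => z1; apply: hB; exists z; split => //; apply/unit_circleE.
(* The trace of [B] on the circle is relatively clopen and non-empty, so [B] contains the circle and
   its complement in the spectrum misses it. *)
have cB : unit_circle R `&` B = unit_circle R.
  apply: unit_circle_connected => //.
    by exists G => //; rewrite BO setIA (setIidl circ).
  by exists F => //; rewrite BF setIA (setIidl circ).
have cplt : sp `\` B = sp `&` ~` F by rewrite setDE BF setCI setIUr setICr set0U.
have cplt' : sp `\` B = sp `&` ~` G by rewrite setDE BO setCI setIUr setICr set0U.
have emp : forall z, ~ (sp `\` B) z.
  apply: clopen_empty (closed_openC cF) (open_closedC oO) cplt cplt' _ => z [_ nB].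
  by apply/eqP => /unit_circleE; rewrite -cB => -[].
apply/seteqP; split => [z|z sz]; first by rewrite BO => -[].
by apply: contrapT => nB; apply: (emp z).
Qed.
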